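(* Let $k\ge 1$ be an integer. For every $i=0,\dots,k$ one has $$\operatorname{Ker} f_{\Lambda_{k,i}} = I_{\Lambda_{k,i}}.$$ In particular, $$\operatorname{Ker} f'_{\Lambda_{k,k}} = I'_{\Lambda_{k,k}}.$$
   Context: Let $\mathfrak g=\mathfrak{sl}(2)=\mathbb C x_{-\alpha}\oplus\mathbb C h\oplus\mathbb C x_\alpha$ over $\mathbb C$, with $[h,x_{\alpha}]=2x_{\alpha}$, $[h,x_{-\alpha}]=-2x_{-\alpha}$, $[x_\alpha,x_{-\alpha}]=h$, and $\langle a,b\rangle=\operatorname{tr}(ab)$. The affine Lie algebra is $\widehat{\mathfrak g}=\mathfrak g\otimes\mathbb C[t,t^{-1}]\oplus\mathbb C\mathbf k$ with $\mathbf k$ central and $[a\otimes t^m,b\otimes t^n]=[a,b]\otimes t^{m+n}+m\langle a,b\rangle\delta_{m+n,0}\mathbf k$. Write $x(m)$ for $x\otimes t^m$ (and for its action on a module). Fix an integer $k\ge1$. For $0\le i\le k$ set $\Lambda_{k,i}=(k-i)\Lambda_0+i\Lambda_1$, where $\Lambda_0,\Lambda_1\in(\mathbb C h\oplus\mathbb C\mathbf k)^*$ are the fundamental weights: $\Lambda_j(\mathbf k)=1$, $\Lambda_j(h)=\delta_{j,1}$. Let $L(\Lambda_{k,i})$ be the level $k$ standard (integrable irreducible highest weight) $\widehat{\mathfrak g}$-module with highest weight $\Lambda_{k,i}$, and $v_{\Lambda_{k,i}}$ a (nonzero) highest weight vector: it is annihilated by $x_\alpha(0)$ and by $\mathfrak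 g\otimes t\mathbb C[t]$, $h(0)$ acts on it by $i$, and $\mathbf k$ acts by $k$. Let $\bar{\mathfrak n}=\mathbb C x_\alpha\otimes\mathbb C[t,t^{-1}]$, $\bar{\mathfrak n}_-=\mathbb C x_\alpha\otimes t^{-1}\mathbb C[t^{-1}]$, $\bar{\mathfrak n}_{\le-2}=\mathbb C x_\alpha\otimes t^{-2}\mathbb C[t^{-1}]$. These are abelian, so $U(\bar{\mathfrak n}_-)=\mathbb C[x_\alpha(-1),x_\alpha(-2),\dots]$ and $U(\bar{\mathfrak n}_{\le-2})=\mathbb C[x_\alpha(-2),x_\alpha(-3),\dots]$ are polynomial algebras. The principal subspace of $L(\Lambda_{k,i})$ is $W(\Lambda_{k,i})=U(\bar{\mathfrak n})\cdot v_{\Lambda_{k,i}}$, which equals $U(\bar{\mathfrak n}_-)\cdot v_{\Lambda_{k,i}}$. Also $W(\Lambda_{k,k})'=U(\bar{\mathfrak n}_{\le-2})\cdot v_{\Lambda_{k,k}}$ (which equals $W(\Lambda_{k,k})$). Define the surjective linear maps $f_{\Lambda_{k,i}}:U(\bar{\mathfrak n}_-)\to W(\Lambda_{k,i})$, $a\mapsto a\cdot v_{\Lambda_{k,i}}$, and $f'_{\Lambda_{k,k}}:U(\bar{\mathfrak n}_{\le-2})\to W(\Lambda_{k,k})'$, $a\mapsto a\cdot v_{\Lambda_{k,k}}$. Define $$R^0_{k,t}=\sum_{\substack{m_1,\dots,m_{k+1}\le-1\\ m_1+\cdots+m_{k+1}=-t}}x_\alpha(m_1)\cdots x_\alpha(m_{k+1})\in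 U(\bar{\mathfrak n}_-)\quad(t\ge k+1),$$ $$R^1_{k,t}=\sum_{\substack{m_1,\dots,m_{k+1}\le-2\\ m_1+\cdots+m_{k+1}=-t}}x_\alpha(m_1)\cdots x_\alpha(m_{k+1})\in U(\bar{\mathfrak n}_{\le-2})\quad(t\ge 2(k+1)),$$ and the ideals $$I_{\Lambda_{k,i}}=\sum_{t\ge k+1}U(\bar{\mathfrak n}_-)R^0_{k,t}+U(\bar{\mathfrak n}_-)x_\alpha(-1)^{k-i+1}\subset U(\bar{\mathfrak n}_-)\quad(0\le i\le k),$$ $$I'_{\Lambda_{k,k}}=\sum_{t\ge 2(k+1)}U(\bar{\mathfrak n}_{\le-2})R^1_{k,t}\subset U(\bar{\mathfrak n}_{\le-2}).$$ (For $i=0$ the second summand is redundant, since $R^0_{k,k+1}=x_\alpha(-1)^{k+1}$.) *)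

(* Defs.v *)
From HB Require Import structures.
From mathcomp Require Import all_boot all_order all_algebra.
From mathcomp Require Import finmap monalg.
From mathcomp Require Import classical_sets reals.
From mathcomp Require Import complex.

Set Implicit Arguments.
Unset Strict Implicit.
Unset Printing Implicit Defensive.

Import Order.TTheory GRing.Theory Num.Theory.

Local Open Scope ring_scope.

(* The basis x_{-alpha}, h, x_alpha of sl(2). *)
Inductive sl2_basis := Xneg | Hcar | Xpos.

Definition sl2_basis_code (e : sl2_basis) : option bool :=
  match e with Xneg => Some false | Hcar => None | Xpos => Some true end.

Definition sl2_basis_decode (c : option bool) : sl2_basis :=
  match c with Some false => Xneg | None => Hcar | Some true => Xpos end.

Lemma sl2_basis_codeK : cancel sl2_basis_code sl2_basis_decode.
Proof. by case. Qed.

HB.instance Definition _ := Choice.copy sl2_basis (can_type sl2_basis_codeK).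

(* sl(2) (x) K[t, t^-1] (+) K k as the free module on the symbols
   Some (e, m) = e (x) t^m and None = k. *)
Notation affine_sl2 K := {malg K[option (sl2_basis * int)%type]}.

(* U(nbar), the polynomial algebra in the variables x_alpha(m), m : int. *)
Notation Unbar K := {malg K[{cmonom int}]}.

Section AffineSl2.
Variable K : fieldType.

Definition sl2_mx (e : sl2_basis) : 'M[K]_2 :=
  match e with
  | Xneg => delta_mx 1 0
  | Hcar => delta_mx 0 0 - delta_mx 1 1
  | Xpos => delta_mx 0 1
  end.


Definition mode (e : sl2_basis) (m : int) : affine_sl2 K := << Some (e, m) >>.

Definition central : affine_sl2 K := << None >>.

(* a (x) t^m for a trace zero matrix a, expanded in the above basis. *)
Definition loop (a : 'M[K]_2) (m : int) : affine_sl2 K :=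
  a 1 0 *: mode Xneg m + a 0 0 *: mode Hcar m + a 0 1 *: mode Xpos m.

Definition bracket_basis (b c : option (sl2_basis * int)) : affine_sl2 K :=
  match b, c with
  | Some (e, m), Some (f, n) =>
      loop (sl2_mx e *m sl2_mx f - sl2_mx f *m sl2_mx e) (m + n)
      + (m%:~R * \tr (sl2_mx e *m sl2_mx f) * (m + n == 0)%:R) *: central
  | _, _ => 0
  end.

Definition bracket (x y : affine_sl2 K) : affine_sl2 K :=
  \sum_(b <- msupp x) \sum_(c <- msupp y)
    (x@_b * y@_c) *: bracket_basis b c.

Section Modules.
Variables (V : lmodType K) (rho : affine_sl2 K -> V -> V).

Definition is_affine_module : Prop :=
  [/\ forall x, linear (rho x),
      forall w, linear (rho^~ w)
    & forall x y w, rho (bracket x y) w = rho x (rho y w) - rho y (rho x w)].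

Definition is_submodule (S : set V) : Prop :=
  [/\ S 0,
      forall (a : K) u w, S u -> S w -> S (a *: u + w)
    & forall x w, S w -> S (rho x w)].

Definition irreducible_module : Prop :=
  (exists w : V, w != 0) /\
  forall S : set V, is_submodule S ->
    (forall w, S w -> w = 0) \/ (forall w, S w).

Definition locally_nilpotent (x : affine_sl2 K) : Prop :=
  forall w, exists n : nat, iter n (rho x) w = 0.

(* Local nilpotency of the Chevalley generators e_1, f_1, e_0, f_0. *)
Definition integrable : Prop :=
  [/\ locally_nilpotent (mode Xpos 0), locally_nilpotent (mode Xneg 0),
      locally_nilpotent (mode Xneg 1) & locally_nilpotent (mode Xpos (-1))].

(* v is a highest weight vector of weight (k - i) Lambda_0 + i Lambda_1. *)
Definition highest_weight_vector (k i : nat) (v : V) : Prop :=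
  [/\ v != 0,
      rho (mode Xpos 0) v = 0,
      forall e (m : int), 0 < m -> rho (mode e m) v = 0,
      rho (mode Hcar 0) v = i%:R *: v
    & rho central v = k%:R *: v].

(* (V, rho) is the standard module L(Lambda_{k,i}), with highest weight vector
   v; this determines (V, rho, v) up to isomorphism. *)
Definition is_standard_module (k i : nat) (v : V) : Prop :=
  [/\ is_affine_module, irreducible_module, integrable
    & highest_weight_vector k i v].

End Modules.

Definition xa (m : int) : Unbar K := << ucm m >>.

(* The subalgebra K[x_alpha(m), m <= c] of U(nbar); thus Unbar_le (-1) is
   U(nbar_-), and Unbar_le (-2) is U(nbar_{<= -2}). *)
Definition Unbar_le (c : int) : set (Unbar K) :=
  [set a | forall u : {cmonom int}, u \in msupp a ->
           forall m : int, m \in finsupp u -> m <= c].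

Section Action.
Variables (V : lmodType K) (rho : affine_sl2 K -> V -> V).

(* The operators rho (mode Xpos m) commute pairwise, so the order in which
   the support of u is enumerated does not matter. *)
Definition monom_act (u : {cmonom int}) (w : V) : V :=
  foldr (fun m : int => iter (u m) (rho (mode Xpos m))) w (finsupp u).

Definition Unbar_act (a : Unbar K) (w : V) : V :=
  \sum_(u <- msupp a) a@_u *: monom_act u w.

Definition principal_subspace (v : V) : set V :=
  [set Unbar_act a v | a in [set: Unbar K]].

(* The kernel of Unbar_le c -> principal_subspace v, a |-> a . v. *)
Definition Ker_f (c : int) (v : V) : set (Unbar K) :=
  [set a | Unbar_le c a /\ Unbar_act a v = 0].

End Action.

(* The sum of x_alpha(m_1) ... x_alpha(m_{k+1}) over all m_j <= -d with
   m_1 + ... + m_{k+1} = -t; here m_j = - p_j, and p_j <= t is automatic. *)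
Definition Rel (d k t : nat) : Unbar K :=
  \sum_(p : {ffun 'I_k.+1 -> 'I_t.+1} |
        [forall j, (d <= p j)%N] && ((\sum_j p j)%N == t))
    \prod_j xa (- (p j)%:Z).

Definition R0 (k t : nat) : Unbar K := Rel 1 k t.
Definition R1 (k t : nat) : Unbar K := Rel 2 k t.

Definition I_Lambda (k i : nat) : set (Unbar K) :=
  [set a | exists (N : nat) (g : nat -> Unbar K) (b : Unbar K),
     [/\ forall t, Unbar_le (-1) (g t), Unbar_le (-1) b
       & a = \sum_(k.+1 <= t < N) g t * R0 k t + b * xa (-1) ^+ (k - i + 1)]].

Definition I'_Lambda (k : nat) : set (Unbar K) :=
  [set a | exists (N : nat) (g : nat -> Unbar K),
     (forall t, Unbar_le (-2) (g t)) /\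
     a = \sum_((2 * k.+1)%N <= t < N) g t * R1 k t].

End AffineSl2.

(* Main.v *)
From HB Require Import structures.
Require Import Defs.
From mathcomp Require Import all_boot all_order all_algebra.
From mathcomp Require Import finmap monalg.
From mathcomp Require Import classical_sets reals complex.
From mathcomp Require Import ring zify.

Set Implicit Arguments.
Unset Strict Implicit.
Unset Printing Implicit Defensive.

Import Order.TTheory GRing.Theory Num.Theory.
Local Open Scope ring_scope.

(** Write x for x_alpha. The subalgebra U(nbar_-) consists of the polynomials in
    x(-1), x(-2), ..., and I_i denotes the ideal attached to the weight i.

    The ideal is contained in the kernel because of two sl(2) triples. A vector of
    h(0)-weight greater than k that is killed by x_{-alpha}(1) vanishes; this
    property ([dominant]) follows from integrability. It makes x(-1)^(k-i+1) v
    vanish, which is a highest weight vector for the affine triple, and, by an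
    induction over the coefficients in which [Y1_rvS] is the key computation, also
    every coefficient of x(z)^(k+1) v.

    The converse has three ingredients.

    Comparison of modules. The scalar by which a word of degree zero in the affine
    algebra acts on a highest weight vector only depends on the level and on the
    weight ([expectation_exists]). In a module with a positive definite
    contravariant form these scalars detect whether a vector is zero. Hence, if an
    element of U(nbar_-) kills some highest weight vector, then its component of
    lowest degree kills every highest weight vector with the same weight in every
    unitary module of the same level ([unitary_kernel]).

    A unitary model. The fermionic Fock space with k colours contains highest
    weight vectors v_0, ..., v_k of all the weights of level k, and fermions that
    commute with all x(m) and map v_i to v_{i+1} ([fock_model]). These replace the
    intertwining operators between the standard modules.

    Descent. Let a be homogeneous, of positive charge, with a v_i = 0 in the Fock
    space ([fock_kernel]). Applying a fermion gives a v_{i+1} = 0, hence a is in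
    I_{i+1} by induction on k - i; for i = k this step is void. Since I_{i+1} is
    generated by the relations and by x(-1)^(k-i), modulo I_i the element a equals
    b x(-1)^(k-i), where x(-1) does not occur in b. Now x(-1)^(k-i) v_i is an
    extremal vector: it is a highest weight vector, of weight k - i, for the
    action twisted by the automorphism x(m) |-> x(m-1) ([twist_hw]). So, by the
    comparison of modules, the element b' obtained from b by the substitution x(m)
    |-> x(m+1) kills v_{k-i}. The energy of b' is closer to zero than that of a,
    therefore b' is in I_{k-i} by induction on the energy; and the reverse
    substitution followed by the multiplication by x(-1)^(k-i) maps I_{k-i} to I_i
    ([relideal_shift]), which rests on two identities for the binomial expansion
    of the relations in powers of x(-1) ([relideal_rel2], [relideal_pow2]).

    The second presentation follows from the first one for i = k. The substitution
    x(-1) |-> 0 fixes U(nbar_{<= -2}), kills the generator x(-1) of I_k and maps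
    the first family of relations to the second one; conversely the second family
    is contained in I_k by [relideal_rel2]. *)

(** * Linear extension *)

Section LinearExtension.
Variables (K : fieldType) (T : choiceType) (V : lmodType K).
Implicit Types (f : T -> V) (w : {malg K[T]}).

Definition lext f w : V := \sum_(t <- msupp w) w@_t *: f t.

Lemma lextEw f (d : {fset T}) w :
  (msupp w `<=` d)%fset -> lext f w = \sum_(t <- d) w@_t *: f t.
Proof.
move=> le; rewrite /lext (big_fset_incl _ le) // => t _ /mcoeff_outdom ->.
by rewrite scale0r.
Qed.

Lemma lext_is_linear f : linear (lext f).
Proof.
move=> a w z; have le1 : (msupp (a *: w + z) `<=` msupp w `|` msupp z)%fset.
  apply: fsubset_trans (msuppD_le _ _) _; apply: fsetSU; exact: msuppZ_le.
rewrite (lextEw _ le1) (lextEw _ (fsubsetUl (msupp w) (msupp z))).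
rewrite (lextEw _ (fsubsetUr (msupp w) (msupp z))) scaler_sumr -big_split /=.
by apply: eq_bigr => t _; rewrite mcoeffD mcoeffZ scalerDl scalerA.
Qed.

HB.instance Definition _ f :=
  GRing.isLinear.Build K {malg K[T]} V *:%R (lext f) (lext_is_linear f).

Lemma lextU f t : lext f << t >> = f t.
Proof. by rewrite /lext msuppU oner_eq0 big_seq_fset1 mcoeffUU scale1r. Qed.

Lemma malg_sumU w : w = \sum_(t <- msupp w) w@_t *: << t >>.
Proof.
rewrite {1}[w]monalgE; apply: eq_bigr => t _; apply/malgP => s.
by rewrite mcoeffZ !mcoeffU; case: eqP; rewrite ?mulr1 ?mulr0.
Qed.

Lemma linear_lext (g : {linear {malg K[T]} -> V}) w :
  g w = lext (fun t => g << t >>) w.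
Proof.
by rewrite {1}[w]malg_sumU linear_sum; apply: eq_bigr => t _; rewrite linearZ.
Qed.

Lemma linear_eq (g h : {linear {malg K[T]} -> V}) :
  (forall t, g << t >> = h << t >>) -> g =1 h.
Proof.
move=> gh w; rewrite (linear_lext g) (linear_lext h).
by apply: eq_bigr => t _; rewrite gh.
Qed.

Lemma malg_ind (P : {malg K[T]} -> Prop) :
  P 0 -> (forall w z, P w -> P z -> P (w + z)) ->
  (forall c t, P (c *: << t >>)) -> forall w, P w.
Proof. by move=> P0 PD PU w; rewrite [w]malg_sumU; apply: big_ind. Qed.

End LinearExtension.

(** * The action of the polynomial algebra *)

Section PolynomialAction.
Variables (K : fieldType) (V : lmodType K) (X : int -> {linear V -> V}).

Definition mact (u : {cmonom int}) (w : V) : V :=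
  foldr (fun m => iter (u m) (X m)) w (finsupp u).

Definition uact (a : Unbar K) (w : V) : V := lext (mact^~ w) a.

Lemma iter_linear n (f : {linear V -> V}) : linear (iter n f).
Proof. by elim: n => [|n IH] a x y //; rewrite !iterS IH linearP. Qed.

Lemma mact_linear u : linear (mact u).
Proof.
rewrite /mact => a x y; elim: (enum_fset _) => //= m s ->.
by rewrite iter_linear.
Qed.

Lemma uact_linear a : linear (uact a).
Proof.
move=> c x y; rewrite /uact /lext scaler_sumr -big_split /=.
by apply: eq_bigr => u _; rewrite mact_linear scalerDr !scalerA mulrC.
Qed.

HB.instance Definition _ a :=
  GRing.isLinear.Build K V V *:%R (uact a) (uact_linear a).

Lemma uactDl a b w : uact (a + b) w = uact a w + uact b w.
Proof. exact: linearD. Qed.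
Lemma uactBl a b w : uact (a - b) w = uact a w - uact b w.
Proof. exact: linearB. Qed.
Lemma uactZl c a w : uact (c *: a) w = c *: uact a w.
Proof. exact: linearZ. Qed.
Lemma uact0l w : uact 0 w = 0.
Proof. exact: linear0. Qed.
Lemma uact_suml I r (P : pred I) F w :
  uact (\sum_(i <- r | P i) F i) w = \sum_(i <- r | P i) uact (F i) w.
Proof. exact: linear_sum. Qed.

Lemma uactU u w : uact << u >> w = mact u w.
Proof. exact: lextU. Qed.

Lemma uact1 w : uact 1 w = w.
Proof. by rewrite uactU /mact mdom1. Qed.

Lemma uact_xa m w : uact (xa K m) w = X m w.
Proof. by rewrite uactU /mact mdomU enum_fsetE /= enum_fset1 /= cmUU. Qed.

Hypothesis XC : forall m n w, X m (X n w) = X n (X m w).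

Lemma iterXC i j m n w :
  iter i (X m) (iter j (X n) w) = iter j (X n) (iter i (X m) w).
Proof.
have X1 l w' : X m (iter l (X n) w') = iter l (X n) (X m w').
  by elim: l => //= l IH; rewrite XC IH.
by elim: i => //= i ->; rewrite X1.
Qed.

Definition sact (f : int -> nat) (s : seq int) (w : V) : V :=
  foldr (fun m => iter (f m) (X m)) w s.

Lemma sact_iterC f s i m w :
  sact f s (iter i (X m) w) = iter i (X m) (sact f s w).
Proof. by elim: s => //= n s ->; rewrite iterXC. Qed.

Lemma sact_perm f s1 s2 w : perm_eq s1 s2 -> sact f s1 w = sact f s2 w.
Proof.
elim: s1 s2 => [|m s1 IH] s2 h.
  by rewrite (perm_nilP (etrans (perm_sym _ _) h)).
have ms2 : m \in s2 by rewrite -(perm_mem h) mem_head.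
case/splitPr: ms2 h => p q.
rewrite perm_sym (perm_catCA p [:: m] q) /= perm_cons perm_sym.
move=> /IH /= ->; rewrite /sact !foldr_cat /=.
by rewrite -/(sact f p) -/(sact f p (iter _ _ _)) sact_iterC.
Qed.

Lemma sact_cat f s1 s2 w : sact f (s1 ++ s2) w = sact f s1 (sact f s2 w).
Proof. exact: foldr_cat. Qed.

Lemma mactEw (u : {cmonom int}) s w :
  uniq s -> {subset finsupp u <= s} -> mact u w = sact u s w.
Proof.
move=> us sub; rewrite -[LHS]/(sact u (finsupp u) w).
rewrite (@sact_perm u s ([seq m <- s | m \in finsupp u] ++
                         [seq m <- s | m \notin finsupp u])); last first.
  by rewrite perm_sym perm_filterC.
rewrite sact_cat.
have -> : sact u [seq m <- s | m \notin finsupp u] w = w.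
  elim: {us sub} s => //= m s IH; case: ifP => //= mu; rewrite IH.
  by rewrite (eqP (_ : u m == 0)%N) // cmE_eq0 mu.
apply: sact_perm; apply: uniq_perm; rewrite ?fset_uniq ?filter_uniq //.
by move=> m; rewrite mem_filter andb_idr //; apply: sub.
Qed.

(** The exponents add because the operators commute; this is what makes the
    action of a product of monomials the composite of their actions. *)
Lemma sactD f g s w : sact (fun m => f m + g m)%N s w = sact f s (sact g s w).
Proof. by elim: s => //= m s ->; rewrite sact_iterC iterD. Qed.

Lemma eq_sact f g s w : f =1 g -> sact f s w = sact g s w.
Proof. by move=> fg; elim: s => //= m s ->; rewrite fg. Qed.

Lemma mactM u1 u2 w : mact (mmul u1 u2) w = mact u1 (mact u2 w).
Proof.
have us := fset_uniq (finsupp (mmul u1 u2)).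
have s1 : {subset finsupp u1 <= finsupp (mmul u1 u2)}.
  by move=> m mu; rewrite mdomD in_fsetU mu.
have s2 : {subset finsupp u2 <= finsupp (mmul u1 u2)}.
  by move=> m mu; rewrite mdomD in_fsetU mu orbT.
rewrite (mactEw _ us s1) (mactEw _ us s2) -sactD.
by rewrite (mactEw w us (fun _ h => h)); apply: eq_sact => m; rewrite cmM.
Qed.

Lemma malgMUU (u1 u2 : {cmonom int}) :
  << u1 >> * << u2 >> = << mmul u1 u2 >> :> Unbar K.
Proof. by rewrite malgM_def fgmulUU mulr1. Qed.

Lemma uactM a b w : uact (a * b) w = uact a (uact b w).
Proof.
move: a; apply: malg_ind => [|a1 a2 h1 h2|c u].
- by rewrite mul0r !uact0l.
- by rewrite mulrDl uactDl [RHS]uactDl; congr (_ + _).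
rewrite -scalerAl [LHS]uactZl [RHS]uactZl; congr (_ *: _).
move: b; apply: malg_ind => [|b1 b2 h1 h2|e v].
- by rewrite mulr0 uact0l linear0.
- by rewrite mulrDr uactDl [in RHS]uactDl [RHS]linearD; congr (_ + _).
rewrite -scalerAr [LHS]uactZl [in RHS]uactZl [RHS]linearZ; congr (_ *: _).
by rewrite malgMUU [LHS]uactU mactM [RHS]uactU uactU.
Qed.

Lemma uactXn a n w : uact (a ^+ n) w = iter n (uact a) w.
Proof. by elim: n => [|n IH]; rewrite ?uact1 // exprS uactM IH. Qed.

End PolynomialAction.

(** * Support conditions and gradings *)

Section Support.
Variable K : fieldType.
Implicit Types (P Q : {cmonom int} -> Prop) (a b : Unbar K) (u v : {cmonom int}).

Definition all_supp P a : Prop := forall u, u \in msupp a -> P u.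

(** An element whose monomials satisfy P is handled one monomial at a time; the
    subalgebras and the homogeneous components are both of this form. *)
Lemma all_supp_ind P (Q : Unbar K -> Prop) :
  Q 0 -> (forall a b, Q a -> Q b -> Q (a + b)) ->
  (forall c u, P u -> Q (c *: << u >>)) -> forall a, all_supp P a -> Q a.
Proof.
move=> Q0 QD QU a Pa; rewrite [a]malg_sumU big_seq.
by apply: big_ind => // u /Pa; apply: QU.
Qed.

Lemma all_supp0 P : all_supp P 0.
Proof. by move=> u; rewrite msupp0 in_fset0. Qed.

Lemma all_suppD P a b : all_supp P a -> all_supp P b -> all_supp P (a + b).
Proof.
move=> Pa Pb u /(fsubsetP (msuppD_le a b)); rewrite in_fsetU => /orP[].
  exact: Pa.
exact: Pb.
Qed.

Lemma all_suppZ P c a : all_supp P a -> all_supp P (c *: a).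
Proof. by move=> Pa u /(fsubsetP (msuppZ_le _ _)); apply: Pa. Qed.

Lemma all_suppU P u : P u -> all_supp P << u >>.
Proof. by move=> Pu v; rewrite msuppU1 in_fset1 => /eqP ->. Qed.

Lemma all_supp_sum P I r (C : pred I) (F : I -> Unbar K) :
  (forall i, C i -> all_supp P (F i)) ->
  all_supp P (\sum_(i <- r | C i) F i).
Proof. by move=> PF; apply: big_ind => //; [exact: all_supp0|exact: all_suppD]. Qed.

Lemma all_suppM P Q S a b :
  (forall u v, P u -> Q v -> S (mmul u v)) ->
  all_supp P a -> all_supp Q b -> all_supp S (a * b).
Proof.
move=> PQS Pa Qb; move: a Pa; apply: (@all_supp_ind P) => [|a1 a2 IH1 IH2|c u Pu].
- by rewrite mul0r; apply: all_supp0.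
- by rewrite mulrDl; apply: all_suppD.
move: b Qb; apply: (@all_supp_ind Q) => [|b1 b2 IH1 IH2|e v Qv].
- by rewrite mulr0; apply: all_supp0.
- by rewrite mulrDr; apply: all_suppD.
rewrite -scalerAl -scalerAr malgMUU; do 2![apply: all_suppZ].
by apply: all_suppU; apply: PQS.
Qed.

(** ** The subalgebras in the variables of index at most c *)

Lemma Ule_sub c c' a : c <= c' -> Unbar_le c a -> Unbar_le c' a.
Proof. by move=> cc' ha u ua m mu; apply: le_trans (ha u ua m mu) cc'. Qed.

Lemma Ule0 c : Unbar_le c (0 : Unbar K).
Proof. exact: all_supp0. Qed.

Lemma Ule1 c : Unbar_le c (1 : Unbar K).
Proof. by apply: all_suppU => m; rewrite mdom1 in_fset0. Qed.

Lemma Ule_xa c m : m <= c -> Unbar_le c (xa K m).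
Proof. by move=> mc; apply: all_suppU => n; rewrite mdomU in_fset1 => /eqP ->. Qed.

Lemma UleD c a b : Unbar_le c a -> Unbar_le c b -> Unbar_le c (a + b).
Proof. exact: all_suppD. Qed.

Lemma UleZ c e a : Unbar_le c a -> Unbar_le c (e *: a).
Proof. exact: all_suppZ. Qed.

Lemma UleB c a b : Unbar_le c a -> Unbar_le c b -> Unbar_le c (a - b).
Proof. by move=> ha hb; rewrite -scaleN1r; apply/UleD/UleZ. Qed.

Lemma UleM c a b : Unbar_le c a -> Unbar_le c b -> Unbar_le c (a * b).
Proof.
apply: all_suppM => u v hu hv m; rewrite mdomD in_fsetU => /orP[].
  exact: hu.
exact: hv.
Qed.

Lemma UleX c a n : Unbar_le c a -> Unbar_le c (a ^+ n).
Proof.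
move=> ha; elim: n => [|n IH]; first exact: Ule1.
by rewrite exprS; apply: UleM.
Qed.

Lemma Ule_sum c I r (C : pred I) (F : I -> Unbar K) :
  (forall i, C i -> Unbar_le c (F i)) ->
  Unbar_le c (\sum_(i <- r | C i) F i).
Proof. exact: all_supp_sum. Qed.

Lemma Ule_prod c I r (C : pred I) (F : I -> Unbar K) :
  (forall i, C i -> Unbar_le c (F i)) ->
  Unbar_le c (\prod_(i <- r | C i) F i).
Proof. by move=> PF; apply: big_ind => //; [exact: Ule1|exact: UleM]. Qed.

(** ** Gradings *)

Section Grading.
Variables (G : zmodType) (wt : int -> G).

Definition deg (u : {cmonom int}) : G := \sum_(m <- finsupp u) wt m *+ u m.

Lemma degEw u (d : {fset int}) :
  (finsupp u `<=` d)%fset -> deg u = \sum_(m <- d) wt m *+ u m.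
Proof.
move=> le; rewrite /deg (big_fset_incl _ le) // => m _; rewrite -cmE_eq0.
by move/eqP ->.
Qed.

Lemma deg1 : deg mone = 0.
Proof. by rewrite /deg mdom1 big_seq_fset0. Qed.

Lemma degU m : deg (ucm m) = wt m.
Proof. by rewrite /deg mdomU big_seq_fset1 cmUU. Qed.

Lemma degM u v : deg (mmul u v) = deg u + deg v.
Proof.
rewrite [LHS]/deg mdomD (degEw (fsubsetUl (finsupp u) (finsupp v))).
rewrite (degEw (fsubsetUr (finsupp u) (finsupp v))) -big_split /=.
by apply: eq_bigr => m _; rewrite cmM mulrnDr.
Qed.

Definition homog d : Unbar K -> Prop := all_supp (fun u => deg u = d).

Lemma homogM d e a b : homog d a -> homog e b -> homog (d + e) (a * b).
Proof. by apply: all_suppM => u v <- <-; rewrite degM. Qed.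

Lemma homog1 : homog 0 1.
Proof. by apply: all_suppU; rewrite deg1. Qed.

Lemma homog_xa m : homog (wt m) (xa K m).
Proof. by apply: all_suppU; rewrite degU. Qed.

Lemma homogX d a n : homog d a -> homog (d *+ n) (a ^+ n).
Proof.
move=> ha; elim: n => [|n IH]; first exact: homog1.
by rewrite exprS mulrS; apply: homogM.
Qed.

Lemma homog_prod I r (F : I -> Unbar K) (d : I -> G) :
  (forall i, homog (d i) (F i)) ->
  homog (\sum_(i <- r) d i) (\prod_(i <- r) F i).
Proof.
move=> hF; elim: r => [|i r IH]; rewrite ?big_nil ?big_cons.
  exact: homog1.
exact: homogM.
Qed.

Definition proj d (a : Unbar K) : Unbar K :=
  [malg u in msupp a => if deg u == d then a@_u else 0].

Lemma mcoeff_proj d a u : (proj d a)@_u = if deg u == d then a@_u else 0.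
Proof. by rewrite mcoeffE; case: msuppP => // _; rewrite if_same. Qed.

Lemma proj0 d : proj d 0 = 0.
Proof. by apply/malgP => u; rewrite mcoeff_proj mcoeff0 if_same. Qed.

Lemma projD d a b : proj d (a + b) = proj d a + proj d b.
Proof.
apply/malgP => u; rewrite mcoeffD !mcoeff_proj mcoeffD.
by case: (_ == d); rewrite ?addr0.
Qed.

Lemma projZ d c a : proj d (c *: a) = c *: proj d a.
Proof.
apply/malgP => u; rewrite mcoeffZ !mcoeff_proj mcoeffZ.
by case: (_ == d); rewrite ?mulr0.
Qed.

Lemma proj_linear d : linear (proj d).
Proof.
by move=> c a b; rewrite projD projZ.
Qed.

HB.instance Definition _ d :=
  GRing.isLinear.Build K (Unbar K) (Unbar K) *:%R (proj d) (proj_linear d).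

Lemma projU d u : proj d << u >> = if deg u == d then << u >> else 0.
Proof.
apply/malgP => v; rewrite mcoeff_proj mcoeffU.
have [->|uv] := eqVneq u v; first by case: ifP; rewrite ?mcoeffUU ?mcoeff0.
rewrite if_same; case: ifP => _; rewrite ?mcoeff0 // mcoeffU.
by rewrite (negbTE uv).
Qed.

Lemma msupp_proj d a u : (u \in msupp (proj d a)) = (u \in msupp a) && (deg u == d).
Proof.
rewrite -!mcoeff_neq0 mcoeff_proj; case: (deg u == d); rewrite ?andbT //.
by rewrite eqxx andbF.
Qed.

Lemma proj_homog d a : homog d (proj d a).
Proof. by move=> u; rewrite msupp_proj => /andP[_ /eqP]. Qed.

Lemma proj_supp P d a : all_supp P a -> all_supp P (proj d a).
Proof. by move=> Pa u; rewrite msupp_proj => /andP[/Pa]. Qed.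

Lemma Ule_proj c d a : Unbar_le c a -> Unbar_le c (proj d a).
Proof. exact: proj_supp. Qed.

Lemma proj_id d a : homog d a -> proj d a = a.
Proof.
move=> ha; apply/malgP => u; rewrite mcoeff_proj; case: ifP => // /negbT nu.
rewrite mcoeff_outdom //; apply: contra nu => /ha ->; exact: eqxx.
Qed.

(** Projecting to a degree commutes with the multiplication by a homogeneous
    element, so that a homogeneous element of an ideal with homogeneous generators
    has homogeneous coefficients. *)
Lemma projM d e a r : homog e r -> proj d (a * r) = proj (d - e) a * r.
Proof.
move=> hr; rewrite [a]malg_sumU mulr_suml !linear_sum mulr_suml /=.
apply: eq_bigr => u _; rewrite -scalerAl !linearZ -scalerAl; congr (_ *: _).
move: r hr; apply: all_supp_ind => [|r1 r2 h1 h2|c v dv].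
- by rewrite !mulr0 linear0.
- rewrite [in LHS]mulrDr [LHS]linearD [RHS]mulrDr.
  by apply: congr2; [exact: h1|exact: h2].
rewrite -[in LHS]scalerAr -[in RHS]scalerAr [LHS]linearZ; congr (_ *: _).
rewrite /= malgMUU [LHS]projU projU degM dv [in RHS]eq_sym subr_eq eq_sym.
by case: (d == _); [rewrite malgMUU|rewrite mul0r].
Qed.

End Grading.

(** ** Substitutions *)

Section Substitution.
Variable theta : int -> Unbar K.

Definition subst_monom (u : {cmonom int}) : Unbar K :=
  \prod_(m <- finsupp u) theta m ^+ u m.

Lemma subst_monomEw (u : {cmonom int}) (d : {fset int}) :
  (finsupp u `<=` d)%fset -> subst_monom u = \prod_(m <- d) theta m ^+ u m.
Proof.
move=> le; rewrite /subst_monom (big_fset_incl _ le) // => m _.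
by rewrite -cmE_eq0 => /eqP ->.
Qed.

Lemma subst_monom_mult : mmorphism subst_monom.
Proof.
split=> [u v|]; last by rewrite /subst_monom mdom1 big_seq_fset0.
rewrite [LHS]/subst_monom mdomD.
rewrite (subst_monomEw (fsubsetUl (finsupp u) (finsupp v))).
rewrite (subst_monomEw (fsubsetUr (finsupp u) (finsupp v))) -big_split /=.
by apply: eq_bigr => m _; rewrite cmM exprD.
Qed.

HB.instance Definition _ := isMultiplicative.Build _ _ subst_monom subst_monom_mult.

Definition subst : Unbar K -> Unbar K := mmap (@malgC _ K) subst_monom.

HB.instance Definition _ := GRing.RMorphism.on subst.

Lemma subst_lext a : subst a = lext subst_monom a.
Proof. by apply: eq_bigr => u _; rewrite mul_malgC. Qed.

Lemma substZ c a : subst (c *: a) = c *: subst a.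
Proof. by rewrite !subst_lext linearZ. Qed.

Lemma substU u : subst << u >> = subst_monom u.
Proof. by rewrite subst_lext lextU. Qed.

Lemma subst_xa m : subst (xa K m) = theta m.
Proof. by rewrite substU /subst_monom mdomU big_seq_fset1 cmUU. Qed.

Lemma Ule_subst c c' a :
  (forall m, m <= c -> Unbar_le c' (theta m)) -> Unbar_le c a ->
  Unbar_le c' (subst a).
Proof.
move=> hth; move: a; apply: all_supp_ind => [|a b|e u hu].
- by rewrite raddf0; apply: Ule0.
- by rewrite raddfD; apply: UleD.
rewrite substZ; apply: UleZ; rewrite substU /subst_monom big_seq.
by apply: Ule_prod => m mu; apply/UleX/hth/hu.
Qed.

Lemma homog_subst (G G' : zmodType) (wt : int -> G) (wt' : int -> G')
    (phi : G -> G') d a :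
  phi 0 = 0 -> {morph phi : x y / x + y} ->
  (forall m, homog wt' (phi (wt m)) (theta m)) -> homog wt d a ->
  homog wt' (phi d) (subst a).
Proof.
move=> phi0 phiD hth; move: a; apply: all_supp_ind => [|a b|e u hu].
- by rewrite raddf0; apply: all_supp0.
- by rewrite raddfD; apply: all_suppD.
have phiMn z n : phi (z *+ n) = phi z *+ n.
  by elim: n => [|n IH]; rewrite ?phi0 // !mulrS phiD IH.
rewrite substZ; apply: all_suppZ; rewrite substU -hu /deg.
rewrite (big_morph phi phiD phi0); apply: homog_prod => m.
by rewrite phiMn; apply: homogX.
Qed.

Lemma uact_subst (V : lmodType K) (X X' : int -> {linear V -> V}) a w :
  (forall m n w, X m (X n w) = X n (X m w)) ->
  (forall m w, uact X (theta m) w = X' m w) ->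
  uact X (subst a) w = uact X' a w.
Proof.
move=> XC XX'; rewrite [a]malg_sumU raddf_sum !uact_suml /=.
apply: eq_bigr => u _; rewrite substZ !uactZl substU uactU; congr (_ *: _).
rewrite /subst_monom /mact; elim: (enum_fset _) => [|m s IH] /=.
  by rewrite big_nil uact1.
rewrite big_cons uactM // IH uactXn //.
by apply: eq_iter => z; rewrite XX'.
Qed.

End Substitution.

Lemma cmonom_ind (P : {cmonom int} -> Prop) :
  P mone -> (forall m u, P u -> P (mmul (ucm m) u)) -> forall u, P u.
Proof.
move=> P1 PM u; move: {2}(mdeg u) (leqnn (mdeg u)) => n.
elim: n u => [|n IH] u; first by rewrite leqn0 mdeg_eq0 => /eqP ->.
have [->//|] := eqVneq u mone; rewrite -mdeg_eq0 mdegE.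
have [->|[m mu]] := fset_0Vmem (finsupp u); first by rewrite big_seq_fset0.
have -> : u = mmul (ucm m) (divcm u (ucm m)).
  apply/eqP/cmP => i; rewrite cmM cmU divcmE cmU subnKC //.
  by case: eqP => // <-; rewrite lt0n cmE_neq0.
rewrite -mdegE mdegM mdegU => _ h; apply/PM/IH.
by rewrite -ltnS -add1n.
Qed.

(** Division by z inside the subalgebra: proved on monomials, one variable at a
    time, so that the quotient stays in the subalgebra. *)
Lemma subst_mod (theta : int -> Unbar K) c z a :
  (forall m, m <= c -> Unbar_le c (theta m)) ->
  (forall m, m <= c -> exists2 b, Unbar_le c b & xa K m = theta m + z * b) ->
  Unbar_le c z -> Unbar_le c a ->
  exists2 b, Unbar_le c b & a = subst theta a + z * b.
Proof.
move=> hc hth hz; move: a; apply: all_supp_ind.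
- by exists 0; [exact: Ule0|rewrite raddf0 mulr0 addr0].
- move=> a1 a2 [b1 h1 e1] [b2 h2 e2]; exists (b1 + b2); first exact: UleD.
  have -> : subst theta (a1 + a2) = subst theta a1 + subst theta a2.
    exact: rmorphD.
  by move: (subst theta a1) (subst theta a2) e1 e2 => s1 s2 -> ->; ring.
move=> e u hu.
suff [b hb eb] : exists2 b, Unbar_le c b & << u >> = subst theta << u >> + z * b.
  exists (e *: b); first exact: UleZ.
  by rewrite substZ -scalerAr -scalerDr -eb.
elim/cmonom_ind: u hu => [|m u IH] hu.
  exists 0; first exact: Ule0.
  rewrite mulr0 addr0; symmetry; exact: (rmorph1 (subst theta)).
have mc : m <= c by apply: hu; rewrite mdomD mdomU in_fsetU in_fset1 eqxx.
have hu' : forall n, n \in finsupp u -> n <= c.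
  by move=> n nu; apply: hu; rewrite mdomD in_fsetU nu orbT.
have [b hb eb] := IH hu'.
have [b' hb' eb'] := hth m mc.
exists (b' * << u >> + theta m * b).
  apply: UleD; apply: UleM => //; last exact: hc.
  exact: all_suppU.
have E1 : << mmul (ucm m) u >> = xa K m * << u >> by symmetry; exact: malgMUU.
have E2 : subst theta << mmul (ucm m) u >> = theta m * subst theta << u >>.
  transitivity (subst theta (xa K m * << u >>)); first by congr subst; exact: E1.
  rewrite rmorphM; apply: congr2; [exact: subst_xa|exact: erefl].
apply: etrans E1 _; rewrite E2.
clear E2 IH; move: eb; move: (subst theta << u >>) => s.
move: (<< u >>) => u' ->.
by move: eb'; move: (theta m) (xa K m) => t x ->; ring.
Qed.

End Support.

(** * The relations as coefficients of a generating series *)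

Section Relations.
Variables (A : comNzRingType) (x : int -> A).
Implicit Types (d k n t T : nat).

Definition cur d p : A := if (d <= p)%N then x (- p%:Z) else 0.

(** The series x(-d) z^d + x(-d-1) z^(d+1) + ..., truncated at T to be a
    polynomial; the truncation does not change the coefficients up to z^T. *)
Definition curs d T : {poly A} := \poly_(p < T.+1) cur d p.

(** The coefficient of z^t in the n-th power of the series: this form gives the
    recursion over n and the binomial expansion. *)
Definition rel d n t : A := (curs d t ^+ n)`_t.

Lemma coef_curs d T p : (p <= T)%N -> (curs d T)`_p = cur d p.
Proof. by move=> pT; rewrite coef_poly ltnS pT. Qed.

Lemma coef_curs_exp d n t T : (t <= T)%N -> (curs d T ^+ n)`_t = rel d n t.
Proof.
suff gen T' : (t <= T)%N -> (t <= T')%N ->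
    (curs d T ^+ n)`_t = (curs d T' ^+ n)`_t by move=> tT; apply: gen.
elim: n t => [|n IH] t tT tT'; first by rewrite !expr0.
rewrite !exprS !coefM; apply: eq_bigr => p _.
have pt : (p <= t)%N by rewrite -ltnS.
rewrite !coef_curs ?(leq_trans pt) //; congr (_ * _).
by apply: IH; apply: leq_trans (leq_subr _ _) _.
Qed.

Lemma rel0 d t : rel d 0 t = (t == 0%N)%:R.
Proof. by rewrite /rel expr0 coef1. Qed.

Lemma relS d n t : rel d n.+1 t = \sum_(p < t.+1) cur d p * rel d n (t - p).
Proof.
rewrite {1}/rel exprS coefM; apply: eq_bigr => p _.
have pt : (p <= t)%N by rewrite -ltnS.
by congr (_ * _); [exact: coef_curs|exact/coef_curs_exp/leq_subr].
Qed.

Lemma rel_low d n t : (t < d * n)%N -> rel d n t = 0.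
Proof.
elim: n t => [|n IH] t; first by rewrite muln0.
rewrite mulnS => tn; rewrite relS big1 // => p _; rewrite /cur.
case: leqP => dp; rewrite ?mul0r // IH ?mulr0 //.
by have := ltn_ord p; lia.
Qed.

Lemma rel_lead d n : rel d n (d * n) = x (- d%:Z) ^+ n.
Proof.
elim: n => [|n IH]; first by rewrite muln0 rel0 expr0.
rewrite relS mulnS.
have dl : (d < (d + d * n).+1)%N by rewrite ltnS leq_addr.
rewrite (bigD1 (Ordinal dl)) //= big1 => [|p /eqP np].
  by rewrite /cur leqnn addKn IH addr0 exprS.
rewrite /cur; case: leqP => dp; rewrite ?mul0r // rel_low ?mulr0 //.
have {}np : (p != d :> nat)%N by apply/eqP => e; apply: np; apply: val_inj.
by have := ltn_ord p; lia.
Qed.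

Lemma curs_split T : (0 < T)%N -> curs 1 T = curs 2 T + x (- 1) *: 'X.
Proof.
move=> T0; apply/polyP => p; rewrite coefD coefZ coefX !coef_poly.
case: ltnP => pT; last by case: eqP pT => [->|]; rewrite ?mulr0 ?addr0 //; lia.
case: p pT => [|[|p]] pT; rewrite /cur /= ?mulr0 ?mulr1 ?add0r ?addr0 //.
Qed.

Lemma rel_binomial n t : rel 1 n t =
  \sum_(j < n.+1) (if (j <= t)%N then x (- 1) ^+ j * rel 2 (n - j) (t - j)
                   else 0) *+ 'C(n, j).
Proof.
rewrite -(@coef_curs_exp _ _ _ t.+1) // curs_split // exprDn coef_sum.
apply: eq_bigr => j _; rewrite coefMn exprZn mulrC -scalerAl coefZ coefXnM.
case: ltnP => // jt; last by rewrite coef_curs_exp //; lia.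
by rewrite mulr0.
Qed.

Lemma Rel_prod_poly d n t :
  rel d n t = \sum_(p : {ffun 'I_n -> 'I_t.+1} |
        [forall j, (d <= p j)%N] && ((\sum_j p j)%N == t))
    \prod_j x (- (p j)%:Z).
Proof.
rewrite /rel; have -> : curs d t ^+ n = \prod_(i < n) curs d t.
  by rewrite prodr_const card_ord.
rewrite /curs poly_def bigA_distr_bigA /= coef_sum [RHS]big_mkcond /=.
apply: eq_bigr => f _.
have -> : \prod_(i < n) (cur d (f i) *: 'X^(f i)) =
          (\prod_i cur d (f i)) *: 'X^(\sum_i f i) :> {poly A}.
  apply: (big_rec3 (fun a b c => a = b *: 'X^c)).
    by rewrite expr0 scale1r.
  move=> i a b c _ ->.
  by rewrite exprD -scalerAl -scalerAr scalerA.
rewrite coefZ coefXn eq_sym; case: forallP => [df|/forallP].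
  case: eqP => _; rewrite ?mulr1 ?mulr0 //.
  by apply: eq_bigr => i _; rewrite /cur df.
rewrite negb_forall => /existsP[i /negbTE ndf].
by rewrite (bigD1 i) //= /cur ndf !mul0r.
Qed.

End Relations.

Lemma rmorph_rel (A B : comNzRingType) (x : int -> A) (y : int -> B)
    (phi : {rmorphism A -> B}) d e n t :
  (forall p, phi (cur x d p) = cur y e p) -> phi (rel x d n t) = rel y e n t.
Proof.
move=> phix; elim: n t => [|n IH] t; first by rewrite !rel0 rmorph_nat.
rewrite !relS rmorph_sum; apply: eq_bigr => p _.
by rewrite rmorphM phix IH.
Qed.

(** A morphism that lowers the mode of each variable by one multiplies the
    series by z, and its n-th power by z^n. *)
Lemma rmorph_rel_shift (A B : comNzRingType) (x : int -> A) (y : int -> B)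
    (phi : {rmorphism A -> B}) d n t :
  (forall p, phi (cur x d p) = cur y d.+1 p.+1) ->
  phi (rel x d n t) = rel y d.+1 n (t + n).
Proof.
move=> phix; rewrite -(@coef_curs_exp _ y _ _ _ (t + n).+1); last by lia.
have -> : curs y d.+1 (t + n).+1 = 'X * map_poly phi (curs x d (t + n)).
  apply/polyP => p; rewrite coefXM coef_map !coef_poly.
  case: p => [|p] /=; first by rewrite /cur ltn0.
  by rewrite ltnS; case: ltnP; rewrite ?phix ?rmorph0.
rewrite exprMn coefXnM ltnNge leq_addl /= addnK -rmorphXn coef_map.
by rewrite coef_curs_exp //; lia.
Qed.

(** * The ideals of relations *)

Section Ideals.
Variables (K : numFieldType) (A : comAlgType K) (x : int -> A) (L : A -> Prop).
Hypothesis L1 : L 1.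
Hypothesis LD : forall a b, L a -> L b -> L (a + b).
Hypothesis LM : forall a b, L a -> L b -> L (a * b).
Hypothesis LZ : forall c a, L a -> L (c *: a).

Let L0 : L 0. Proof. by rewrite -(scale0r (1 : A)); apply: LZ. Qed.

Let Lsum I (r : seq I) (P : pred I) (F : I -> A) :
  (forall i, P i -> L (F i)) -> L (\sum_(i <- r | P i) F i).
Proof. by move=> LF; apply: big_ind. Qed.

Let LX a n : L a -> L (a ^+ n).
Proof. by move=> La; elim: n => [|n IH]; rewrite ?exprS //; apply: LM. Qed.

Lemma L_rel d n t : (forall p, (d <= p)%N -> L (x (- p%:Z))) -> L (rel x d n t).
Proof.
move=> Lx; elim: n t => [|n IH] t; first by rewrite rel0; case: eqP.
rewrite relS; apply: Lsum => p _; apply: LM => //; rewrite /cur.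
by case: ifP => // dp; apply: Lx.
Qed.

Definition relspan m (r : nat -> A) (a : A) : Prop :=
  exists (N : nat) (g : nat -> A),
    (forall t, L (g t)) /\ a = \sum_(m <= t < N) g t * r t.

Lemma relspan_pad m r N N' (g : nat -> A) : (N <= N')%N ->
  \sum_(m <= t < N) g t * r t =
  \sum_(m <= t < N') (if (t < N)%N then g t else 0) * r t.
Proof.
move=> NN'; rewrite !(big_nat_widenl m 0) // (big_nat_widen 0 N N') //.
rewrite big_mkcond [RHS]big_mkcond; apply: eq_bigr => t _.
by case: (m <= t)%N; case: (t < N)%N; rewrite //= mul0r.
Qed.

Lemma relspanD m r a b :
  relspan m r a -> relspan m r b -> relspan m r (a + b).
Proof.
move=> [N1 [g1 [Lg1 ->]]] [N2 [g2 [Lg2 ->]]].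
rewrite (@relspan_pad _ _ N1 (maxn N1 N2)) ?leq_maxl //.
rewrite (@relspan_pad _ _ N2 (maxn N1 N2)) ?leq_maxr //.
exists (maxn N1 N2), (fun t => (if (t < N1)%N then g1 t else 0) +
                               (if (t < N2)%N then g2 t else 0)).
split=> [t|]; first by apply: LD; case: ifP.
by rewrite -big_split; apply: eq_bigr => t _; rewrite mulrDl.
Qed.

Lemma relspanM m r a c : L c -> relspan m r a -> relspan m r (c * a).
Proof.
move=> Lc [N [g [Lg ->]]]; exists N, (fun t => c * g t).
split=> [t|]; first exact: LM.
by rewrite mulr_sumr; apply: eq_bigr => t _; rewrite mulrA.
Qed.

Lemma relspan0 m r : relspan m r 0.
Proof. by exists 0%N, (fun=> 0); split=> //; rewrite big_geq. Qed.

(** The relations below the first index m vanish for reasons of weight, so that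
    every index may be used. *)
Lemma relspan_gen m (r : nat -> A) t :
  (forall t, (t < m)%N -> r t = 0) -> relspan m r (r t).
Proof.
move=> r0; case: (ltnP t m) => [/r0 ->|mt]; first exact: relspan0.
exists t.+1, (fun s => (s == t)%:R); split=> [s|]; first by case: (s == t).
rewrite big_nat_recr //= eqxx mul1r big_nat big1 ?add0r // => s.
by case/andP => _ st; rewrite ltn_eqF // mul0r.
Qed.

Lemma relspan_sum m r I (s : seq I) (P : pred I) (F : I -> A) :
  (forall i, P i -> relspan m r (F i)) ->
  relspan m r (\sum_(i <- s | P i) F i).
Proof.
by move=> rF; apply: big_ind => //; [exact: relspan0|exact: relspanD].
Qed.

(** The ideals are studied over an arbitrary algebra A with a subalgebra L in
    which the coefficients are taken. *)
Definition relideal k i (a : A) : Prop :=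
  exists s b, [/\ relspan k.+1 (rel x 1 k.+1) s, L b
    & a = s + b * x (- 1) ^+ (k - i + 1)].

Section Fixed.
Variables (k i : nat).
Local Notation J := (relideal k i).

Lemma relidealD a b : J a -> J b -> J (a + b).
Proof.
move=> [s [b1 [hs h1 ->]]] [s' [b2 [hs' h2 ->]]]; exists (s + s'), (b1 + b2).
by split; [exact: relspanD|exact: LD|rewrite mulrDl addrACA].
Qed.

Lemma relidealM c a : L c -> J a -> J (c * a).
Proof.
move=> Lc [s [b [hs hb ->]]]; exists (c * s), (c * b).
by split; [exact: relspanM|exact: LM|rewrite mulrDr mulrA].
Qed.

Lemma relideal0 : J 0.
Proof.
exists 0, 0; split=> //; first exact: relspan0.
by rewrite mul0r addr0.
Qed.

Lemma relidealN a : J a -> J (- a).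
Proof. by rewrite -mulN1r -scaleN1r; apply/relidealM/LZ. Qed.

Lemma relidealB a b : J a -> J b -> J (a - b).
Proof. by move=> Ja /relidealN; apply: relidealD. Qed.

Lemma relideal_sum I (s : seq I) (P : pred I) (F : I -> A) :
  (forall i, P i -> J (F i)) -> J (\sum_(i <- s | P i) F i).
Proof.
by move=> JF; apply: big_ind => //; [exact: relideal0|exact: relidealD].
Qed.

Lemma relideal_span s : relspan k.+1 (rel x 1 k.+1) s -> J s.
Proof. by move=> hs; exists s, 0; split=> //; rewrite mul0r addr0. Qed.

Lemma relideal_rel t : J (rel x 1 k.+1 t).
Proof.
apply: relideal_span; apply: relspan_gen => s sk.
by rewrite rel_low // mul1n.
Qed.

Lemma relideal_pow c : L c -> J (c * x (- 1) ^+ (k - i + 1)).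
Proof. by move=> Lc; exists 0, c; split; rewrite ?add0r //; apply: relspan0. Qed.

Hypothesis Lx : forall p, (0 < p)%N -> L (x (- p%:Z)).

Lemma relideal_powS c j : L c -> J (c * x (- 1) ^+ (k - i + j.+1)).
Proof.
move=> Lc; rewrite -[j.+1]add1n addnA exprD mulrA mulrAC; apply: relideal_pow.
by apply: LM => //; apply/LX/Lx.
Qed.

(** The terms of the binomial expansion of a relation that contain x(-1)
    disappear modulo the next power of x(-1). *)
Lemma relideal_rel2 t : J (x (- 1) ^+ (k - i) * rel x 2 k.+1 t).
Proof.
have e := rel_binomial x k.+1 t; rewrite big_ord_recl /= bin0 expr0 mul1r in e.
rewrite !subn0 in e; rewrite (_ : rel x 2 _ _ = rel x 1 k.+1 t -
   \sum_(j < k.+1) (if (j.+1 <= t)%N then x (- 1) ^+ j.+1 *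
   rel x 2 (k.+1 - j.+1) (t - j.+1) else 0) *+ 'C(k.+1, j.+1)); last first.
  by rewrite e addrK.
rewrite mulrBr mulr_sumr; apply: relidealB.
  by apply: relidealM; [apply/LX/(Lx (ltn0Sn 0))|exact: relideal_rel].
apply: relideal_sum => j _; case: ifP => _; last first.
  by rewrite mul0rn mulr0; apply: relideal0.
rewrite -mulrnAr mulrA -exprD mulrC; apply: relideal_powS.
by rewrite -scaler_nat; apply: LZ; apply: L_rel => p' p0; apply: Lx; lia.
Qed.

(** In the relation of weight k + i + 2, the monomials with fewer than k - i
    factors x(-1) have too large a weight, so that the term displayed here is
    the only one which survives modulo the next power of x(-1). *)
Lemma relideal_pow2 : (i <= k)%N ->
  J (x (- 1) ^+ (k - i) * x (- 2) ^+ i.+1).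
Proof.
move=> ik; have e := rel_binomial x k.+1 (k - i + 2 * i.+1).
have jl : (k - i < k.+2)%N by lia.
rewrite (bigD1 (Ordinal jl)) //= leq_addr addKn in e.
rewrite (_ : k.+1 - (k - i) = i.+1)%N in e; last by lia.
rewrite rel_lead in e.
have nz : ('C(k.+1, k - i))%:R != 0 :> K.
  by rewrite pnatr_eq0 -lt0n bin_gt0; lia.
rewrite -[X in J X](scalerK nz) scaler_nat -mulr_algl.
apply: relidealM; first exact: LZ.
rewrite -[_ *+ _](addrK (\sum_(j < k.+2 | j != Ordinal jl)
  (if (j <= k - i + 2 * i.+1)%N then x (- 1) ^+ j *
   rel x 2 (k.+1 - j) (k - i + 2 * i.+1 - j) else 0) *+ 'C(k.+1, j))) -e.
apply: relidealB; first exact: relideal_rel.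
apply: relideal_sum => j /eqP nj.
have {}nj : (j != k - i :> nat)%N.
  by apply/eqP => ej; apply: nj; apply: val_inj.
case: ifP => jw; last by rewrite mul0rn; apply: relideal0.
case: (ltnP j (k - i)) => jk.
  rewrite rel_low ?mulr0 ?mul0rn; first exact: relideal0.
  by have := ltn_ord j; lia.
rewrite -mulrnAr mulrC (_ : (j : nat) = (k - i + (j - (k - i)).-1.+1)%N).
  apply: relideal_powS; rewrite -scaler_nat; apply: LZ.
  by apply: L_rel => p p0; apply: Lx; lia.
by lia.
Qed.

End Fixed.
End Ideals.

(** * Currents of level k and highest weight vectors *)

Fact cancel_middle (V : zmodType) (y s r a b c : V) :
  y + s - r + a - (b + s) + c = y - r + (a - b + c).
Proof.
by rewrite (addrAC y s) (addrAC _ s) [b + s]addrC addrKA !addrA.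
Qed.

Section Sl2Module.
Variables (K : numFieldType) (V : lmodType K) (e f h : {linear V -> V}).
Hypothesis efh : forall w, e (f w) = f (e w) + h w.
Hypothesis hfE : forall w, h (f w) = f (h w) - 2 *: f w.
Variables (w : V) (mu : K).
Hypotheses (ew : e w = 0) (hw : h w = mu *: w).

Lemma sl2_weight n : h (iter n f w) = (mu - 2 * n%:R) *: iter n f w.
Proof.
elim: n => [|n IH]; first by rewrite mulr0 subr0.
by rewrite iterS hfE IH linearZ -scalerBl; congr (_ *: _); rewrite -natr1; ring.
Qed.

(** The classical formula for a highest weight vector; it makes the weight a
    natural number as soon as f is nilpotent on w. *)
Lemma sl2_raise n : e (iter n.+1 f w) = (n.+1%:R * (mu - n%:R)) *: iter n f w.
Proof.
elim: n => [|n IH].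
  by rewrite /= efh ew linear0 add0r hw subr0 mul1r.
rewrite iterS efh IH linearZ sl2_weight -iterS -scalerDl.
by congr (_ *: _); rewrite -!natr1; ring.
Qed.

Lemma sl2_nilp_weight N : iter N f w = 0 -> w = 0 \/ exists n : nat, mu = n%:R.
Proof.
elim: N => [|N IH]; first by left.
move=> fw; have /eqP := sl2_raise N; rewrite fw linear0 eq_sym scaler_eq0.
rewrite mulf_eq0 pnatr_eq0 /= => /orP[|/eqP]; last exact: IH.
by rewrite subr_eq0 => /eqP ->; right; exists N.
Qed.

End Sl2Module.

(** The structure constants of the affine algebra, in the form
    [e(m), f(n)] = br e f * (tg e f)(m + n) + m * kf e f * delta(m + n, 0) * k,
    which lets the level k currents be described by a single equation. *)
Definition br (e f : sl2_basis) : int :=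
  match e, f with
  | Xpos, Xneg => 1 | Xneg, Xpos => -1
  | Hcar, Xpos => 2 | Xpos, Hcar => -2
  | Hcar, Xneg => -2 | Xneg, Hcar => 2
  | _, _ => 0
  end.

Definition tg (e f : sl2_basis) : sl2_basis :=
  match e, f with
  | Hcar, _ => f | _, Hcar => e | _, _ => Hcar
  end.

Definition kf (e f : sl2_basis) : int :=
  match e, f with
  | Xpos, Xneg | Xneg, Xpos => 1 | Hcar, Hcar => 2 | _, _ => 0
  end.

Definition chg (e : sl2_basis) : int :=
  match e with Xpos => 1 | Hcar => 0 | Xneg => -1 end.

Record currents (K : numFieldType) (k : nat) (V : lmodType K) := Currents {
  cop : sl2_basis -> int -> {linear V -> V};
  copC : forall e f m n w, cop e m (cop f n w) =
    cop f n (cop e m w) + (br e f)%:~R *: cop (tg e f) (m + n) w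
    + ((m * kf e f)%:~R * (m + n == 0)%:R * k%:R) *: w }.

Record hw_vector (K : numFieldType) (k : nat) (V : lmodType K)
    (C : currents k V) (i : nat) (v : V) : Prop := HwVector {
  hw_neq0 : v != 0;
  hw_X0 : cop C Xpos 0 v = 0;
  hw_pos : forall e m, 0 < m -> cop C e m v = 0;
  hw_H0 : cop C Hcar 0 v = i%:R *: v }.

(** The common consequence of integrability and of unitarity: for each of the two
    sl(2) triples of the simple roots, a nonzero highest weight vector has a
    nonnegative weight. For the affine root that weight is k - h(0). *)
Record dominant (K : numFieldType) (k : nat) (V : lmodType K)
    (C : currents k V) : Prop := Dominant {
  dom1 : forall w (l : int), cop C Xpos 0 w = 0 ->
    cop C Hcar 0 w = l%:~R *: w -> l < 0 -> w = 0;
  dom0 : forall w (l : int), cop C Xneg 1 w = 0 ->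
    cop C Hcar 0 w = l%:~R *: w -> k%:Z < l -> w = 0 }.

Section CurrentsTheory.
Variables (K : numFieldType) (k : nat) (V : lmodType K) (C : currents k V).
Local Notation X := (cop C Xpos).
Local Notation Y := (cop C Xneg).
Local Notation H := (cop C Hcar).

Lemma copXX m n w : X m (X n w) = X n (X m w).
Proof. by rewrite copC /= mulr0 !mul0r !scale0r !addr0. Qed.

Lemma copHX m n w : H m (X n w) = X n (H m w) + 2 *: X (m + n) w.
Proof. by rewrite copC /= mulr0 !mul0r scale0r addr0. Qed.

Lemma copHY m n w : H m (Y n w) = Y n (H m w) - 2 *: Y (m + n) w.
Proof. by rewrite copC /= mulr0 !mul0r scale0r addr0 scaleNr. Qed.

Lemma copYX m n w : Y m (X n w) =
  X n (Y m w) - H (m + n) w + (m%:~R * (m + n == 0)%:R * k%:R) *: w.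
Proof. by rewrite copC /= mulr1 scaleN1r. Qed.

Lemma copXY m n w : X m (Y n w) =
  Y n (X m w) + H (m + n) w + (m%:~R * (m + n == 0)%:R * k%:R) *: w.
Proof. by rewrite copC /= mulr1 scale1r. Qed.

(** ** Coefficients of powers of the current x *)

(** The coefficient of z^t in x(z)^n applied to u, where x(z) is the sum of
    x(-p) z^p over p >= 0. The mode 0 is included, although x(0) kills v, because
    the brackets with x_{-alpha}(0) then have a uniform form. *)
Fixpoint rv (n t : nat) (u : V) : V :=
  if n is n'.+1 then \sum_(p < t.+1) X (- p%:Z) (rv n' (t - p) u)
  else if t == 0%N then u else 0.

Lemma rvS n t u : rv n.+1 t u = \sum_(p < t.+1) X (- p%:Z) (rv n (t - p) u).
Proof. by []. Qed.

Lemma rv_zero n t : rv n t 0 = 0.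
Proof.
elim: n t => [|n IH] t; first by rewrite /= if_same.
by rewrite rvS big1 // => p _; rewrite IH linear0.
Qed.

Lemma X_rv m n t u : X m (rv n t u) = rv n t (X m u).
Proof.
elim: n t => [|n IH] t; first by rewrite /=; case: ifP; rewrite ?linear0.
by rewrite !rvS linear_sum; apply: eq_bigr => p _; rewrite /= copXX IH.
Qed.

Lemma H0_rv n t u l : H 0 u = l *: u ->
  H 0 (rv n t u) = (l + 2 * n%:R) *: rv n t u.
Proof.
move=> hu; elim: n t => [|n IH] t.
  by rewrite mulr0 addr0 /=; case: ifP; rewrite ?linear0 ?scaler0.
rewrite rvS linear_sum scaler_sumr; apply: eq_bigr => p _.
rewrite /= copHX add0r IH linearZ -scalerDl; congr (_ *: _).
by rewrite -natr1; ring.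
Qed.

Definition vacuumlike u := forall e m, 0 < m -> cop C e m u = 0.

Lemma vacuumlike_Y0 u : vacuumlike u -> vacuumlike (Y 0 u).
Proof.
move=> hu e m m0; rewrite copC !hu ?addr0 // linear0 scaler0 add0r.
by rewrite (gt_eqF m0) mulr0 mul0r scale0r addr0.
Qed.

Lemma H1_rv0 n u : vacuumlike u -> H 1 (rv n 0 u) = 0.
Proof.
move=> hu; elim: n => [|n IH]; first exact: hu.
rewrite rvS big_ord1 subnn oppr0 copHX IH linear0 X_rv hu // rv_zero.
by rewrite scaler0 addr0.
Qed.

Lemma H1_rvS n t u : vacuumlike u ->
  H 1 (rv n t.+1 u) = (2 * n%:R) *: rv n t u.
Proof.
move=> hu; elim: n t => [|n IH] t; first by rewrite linear0 mulr0 scale0r.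
rewrite [in LHS]rvS linear_sum.
under eq_bigr => p _ do rewrite /= copHX.
rewrite big_split /= -scaler_sumr.
have -> : \sum_(p < t.+2) X (- p%:Z) (H 1 (rv n (t.+1 - p) u)) =
          (2 * n%:R) *: rv n.+1 t u.
  rewrite big_ord_recr /= subnn H1_rv0 // linear0 addr0 scaler_sumr.
  by apply: eq_bigr => p _ /=; rewrite subSn ?IH ?linearZ // -ltnS.
have -> : \sum_(p < t.+2) X (1 - p%:Z) (rv n (t.+1 - p) u) = rv n.+1 t u.
  rewrite big_ord_recl X_rv hu // rv_zero add0r.
  by apply: eq_bigr => p _; congr (X _ _); rewrite /= /bump /=; lia.
by rewrite -scalerDl; congr (_ *: _); rewrite -natr1; ring.
Qed.

Lemma Y1_rv0 n u : vacuumlike u -> Y 1 (rv n 0 u) = 0.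
Proof.
move=> hu; elim: n => [|n IH]; first exact: hu.
rewrite rvS big_ord1 subnn oppr0 copYX IH linear0 H1_rv0 // subr0 add0r.
by rewrite mulr0 mul0r scale0r.
Qed.

(** The bracket with x_{-alpha}(1) is, up to the shift of the weight by one, the
    bracket with x_{-alpha}(0); the correction is a lower power of x(z), with a
    coefficient which vanishes exactly at the power k + 1. *)
Lemma Y1_rvS n t u : vacuumlike u ->
  Y 1 (rv n t.+1 u) = Y 0 (rv n t u) - rv n t (Y 0 u)
    + (n%:R * (k%:R + 1 - n%:R)) *: rv n.-1 t u.
Proof.
move=> hu; elim: n t => [|n IH] t.
  rewrite /= [LHS]linear0 mul0r scale0r addr0.
  by case: eqP => _; [rewrite subrr|rewrite [Y 0 _]linear0 subrr].
rewrite [in LHS]rvS linear_sum.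
under eq_bigr => p _ do rewrite /= copYX.
rewrite big_split sumrB /=.
have -> : \sum_(p < t.+2) (1%:~R * (1 + - p%:Z == 0)%:R * k%:R) *:
    rv n (t.+1 - p) u = k%:R *: rv n t u.
  rewrite big_ord_recl big_ord_recl big1 /= => [|p _].
    by rewrite mulr0 mul0r scale0r add0r addr0 subn1 mulr1 mul1r.
  by rewrite mulr0 mul0r scale0r.
have -> : \sum_(p < t.+2) H (1 - p%:Z) (rv n (t.+1 - p) u) =
    (2 * n%:R) *: rv n t u + \sum_(p < t.+1) H (- p%:Z) (rv n (t - p) u).
  rewrite big_ord_recl /= H1_rvS //; congr (_ + _).
  by apply: eq_bigr => p _; congr (H _ _); rewrite /= /bump /=; lia.
have -> : \sum_(p < t.+2) X (- p%:Z) (Y 1 (rv n (t.+1 - p) u)) =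
    Y 0 (rv n.+1 t u) + \sum_(p < t.+1) H (- p%:Z) (rv n (t - p) u)
    - rv n.+1 t (Y 0 u) + (n%:R * (k%:R + 1 - n%:R)) *: rv n t u.
  rewrite big_ord_recr /= subnn Y1_rv0 // linear0 addr0 linear_sum /=.
  rewrite -big_split -sumrB /=.
  have -> : (n%:R * (k%:R + 1 - n%:R)) *: rv n t u = \sum_(p < t.+1)
      (n%:R * (k%:R + 1 - n%:R)) *: X (- p%:Z) (rv n.-1 (t - p) u).
    by case: n {IH} => [|n]; rewrite -scaler_sumr // mul0r !scale0r.
  rewrite -big_split; apply: eq_bigr => p _ /=.
  have pt : (p <= t)%N by rewrite -ltnS.
  rewrite subSn // IH linearD linearB linearZ /=; congr (_ - _ + _).
  by rewrite copYX add0r !mul0r scale0r addr0 subrK.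
set S := \sum_(p < _) H _ _; rewrite /=.
have -> : (n.+1%:R * (k%:R + 1 - n.+1%:R)) *: rv n t u =
  (n%:R * (k%:R + 1 - n%:R)) *: rv n t u - (2 * n%:R) *: rv n t u
   + k%:R *: rv n t u.
  by rewrite -scalerBl -scalerDl; congr (_ *: _); rewrite -natr1; ring.
exact: cancel_middle.
Qed.

(** The coroot of the affine simple root, k - h(0); its triple consists of
    x_{-alpha}(1), x_alpha(-1) and itself. *)
Definition coroot0 : {linear V -> V} := k%:R \*: idfun \- H 0.

Lemma copYX_coroot0 w : Y 1 (X (-1) w) = X (-1) (Y 1 w) + coroot0 w.
Proof. by rewrite copYX subrr !mul1r -addrA; congr (_ + _); rewrite addrC. Qed.

Lemma coroot0_copX w : coroot0 (X (-1) w) = X (-1) (coroot0 w) - 2 *: X (-1) w.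
Proof. by rewrite /coroot0 /= copHX add0r linearB linearZ opprD addrA. Qed.

Lemma nilpotent_dominant :
  (forall w, exists N, iter N (Y 0) w = 0) ->
  (forall w, exists N, iter N (X (-1)) w = 0) -> dominant C.
Proof.
move=> nY nX; split=> w l ew hw ll.
  have [N fN] := nY w.
  case: (@sl2_nilp_weight _ _ (X 0) (Y 0) (H 0) _ _ w _ ew hw N fN)
    => [u|u|//|[n]].
  - by rewrite copXY !mul0r scale0r addr0 addr0.
  - by rewrite copHY addr0.
  by rewrite -[n%:R]/(n%:~R) => /intr_inj en; rewrite en in ll.
have [N fN] := nX w.
have hw' : coroot0 w = (k%:R - l%:~R) *: w by rewrite /coroot0 /= hw scalerBl.
case: (sl2_nilp_weight copYX_coroot0 coroot0_copX ew hw' fN) => [//|[n]].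
move/eqP; rewrite subr_eq => /eqP e; move: ll; suff -> : k%:Z = n%:Z + l by lia.
by apply: (@intr_inj K); rewrite rmorphD.
Qed.

Section HighestWeight.
Variables (i : nat) (v : V).
Hypotheses (ik : (i <= k)%N) (dC : dominant C) (hv : hw_vector C i v).

Let u j := iter j (Y 0) v.

Let uE (j : nat) : vacuumlike (u j).
Proof. by elim: j => [|j IH]; [exact: (hw_pos hv)|exact: vacuumlike_Y0]. Qed.

Let XYH0 w : X 0 (Y 0 w) = Y 0 (X 0 w) + H 0 w.
Proof. by rewrite copXY !mul0r scale0r !addr0. Qed.

Let HY0 w : H 0 (Y 0 w) = Y 0 (H 0 w) - 2 *: Y 0 w.
Proof. by rewrite copHY addr0. Qed.

Let uH (j : nat) : H 0 (u j) = (i%:Z - 2 * j%:Z)%:~R *: u j.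
Proof.
rewrite (sl2_weight HY0 (hw_H0 hv)); congr (_ *: _).
by rewrite rmorphB rmorphM.
Qed.

Let u_nil (j : nat) : (i < j)%N -> u j = 0.
Proof.
move=> ij; have -> : u j = iter (j - i.+1) (Y 0) (u i.+1).
  by rewrite /u -iterD subnK.
have -> : u i.+1 = 0.
  apply: (dom1 dC) (uH _) _; last by lia.
  rewrite (sl2_raise XYH0 HY0 (hw_X0 hv) (hw_H0 hv)).
  by rewrite subrr mulr0 scale0r.
by elim: (j - _)%N => //= n ->; rewrite linear0.
Qed.

Let rvH t j : H 0 (rv k.+1 t (u j)) =
  (i%:Z - 2 * j%:Z + 2 * k.+1%:Z)%:~R *: rv k.+1 t (u j).
Proof. by rewrite (H0_rv _ _ (uH j)) [in RHS]intrD intrM. Qed.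

Let rv_u t j : rv k.+1 t (u j) = 0.
Proof.
elim: t j => [|t IH] j; (case: (ltnP i j) => ij; first by rewrite u_nil ?rv_zero);
  apply: (dom0 dC _ (rvH _ _)); try by lia.
  exact/Y1_rv0/uE.
rewrite Y1_rvS; last exact: uE.
rewrite IH linear0 (IH j.+1) subr0 add0r.
by rewrite -natr1 subrr mulr0 scale0r.
Qed.

Lemma uact_rel n t : uact X (rel (xa K) 1 n t) v = rv n t v.
Proof.
elim: n t => [|n IH] t.
  by rewrite rel0 /=; case: eqP => _; rewrite ?uact1 ?uact0l.
rewrite relS uact_suml rvS; apply: eq_bigr => p _.
rewrite uactM; last exact: copXX.
rewrite IH /cur; case: ltnP => p0; first by rewrite uact_xa.
rewrite uact0l (_ : (p : nat) = 0%N) ?oppr0; last by lia.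
by rewrite X_rv (hw_X0 hv) rv_zero.
Qed.

(** The coefficients of x(z)^(k+1) vanish on all vectors u j = x_{-alpha}(0)^j v
    at once, by induction on the power t of z. By Y1_rvS, x_{-alpha}(1) maps the
    coefficient t + 1 to the coefficients t, hence to zero, and the weight
    i - 2j + 2(k+1) is larger than k when j <= i; so dom0 applies. *)
Lemma hw_rel t : uact X (rel (xa K) 1 k.+1 t) v = 0.
Proof. by rewrite uact_rel (rv_u t 0). Qed.

Let hv0 : coroot0 v = (k%:R - i%:R) *: v.
Proof. by rewrite /coroot0 /= (hw_H0 hv) scalerBl. Qed.

Lemma hw_raise n : Y 1 (iter n.+1 (X (-1)) v) =
  (n.+1%:R * (k%:R - i%:R - n%:R)) *: iter n (X (-1)) v.
Proof.
have Yv : Y 1 v = 0 by apply: (hw_pos hv).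
exact: (sl2_raise copYX_coroot0 coroot0_copX Yv hv0 n).
Qed.

Lemma hw_H0_iter n : H 0 (iter n (X (-1)) v) =
  (i%:Z + 2 * n%:Z)%:~R *: iter n (X (-1)) v.
Proof.
have := sl2_weight coroot0_copX hv0 n; rewrite /coroot0 /= => e.
rewrite -[LHS](subKr (k%:R *: iter n (X (-1)) v)) e -scalerBl.
by congr (_ *: _); rewrite rmorphD rmorphM; ring.
Qed.

(** The vectors x(-1)^n v form a string for the affine sl(2) triple, which starts
    at the weight k - i of coroot0 and cannot go beyond its length. *)
Lemma hw_pow : iter (k - i + 1) (X (-1)) v = 0.
Proof.
apply: (dom0 dC _ (hw_H0_iter _)); last by lia.
by rewrite addn1 hw_raise natrB // subrr mulr0 scale0r.
Qed.

Lemma hw_pow_neq0 n : (n <= k - i)%N -> iter n (X (-1)) v != 0.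
Proof.
elim: n => [|n IH] nk; first exact: (hw_neq0 hv).
apply/eqP => e; have := hw_raise n; rewrite e linear0 => /esym/eqP.
rewrite scaler_eq0 (negbTE (IH (ltnW nk))) orbF mulf_eq0 pnatr_eq0 /=.
by rewrite -addrA -opprD -natrD subr_eq0 eqr_nat; lia.
Qed.

Lemma hw_X m : 0 <= m -> X m v = 0.
Proof.
rewrite le_eqVlt => /predU1P[<-|]; first exact: (hw_X0 hv).
exact: (hw_pos hv).
Qed.

Lemma hw_Xpow m n : 0 <= m -> X m (iter n (X (-1)) v) = 0.
Proof.
move=> m0; elim: n => [|n IH]; first exact: hw_X.
by rewrite iterS copXX IH linear0.
Qed.

Lemma hw_Hpow m n : 0 < m -> H m (iter n (X (-1)) v) = 0.
Proof.
move=> m0; elim: n => [|n IH]; first exact: (hw_pos hv).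
by rewrite iterS copHX IH linear0 hw_Xpow ?scaler0 ?addr0 //; lia.
Qed.

Lemma hw_Ypow q n : 1 < q -> Y q (iter n (X (-1)) v) = 0.
Proof.
move=> q1; elim: n => [|n IH]; first by apply: (hw_pos hv); lia.
rewrite iterS copYX IH linear0 hw_Hpow ?subr0 ?add0r; last by lia.
by rewrite (_ : (q + -1 == 0) = false) ?mulr0 ?mul0r ?scale0r //; lia.
Qed.

End HighestWeight.

End CurrentsTheory.

Section RelidealKernel.
Variables (K : numFieldType) (k : nat) (V : lmodType K) (C : currents k V).
Variables (i : nat) (v : V).
Hypotheses (ik : (i <= k)%N) (dC : dominant C) (hv : hw_vector C i v).
Local Notation X := (cop C Xpos).

(** One inclusion of the presentation: the generators of the ideal kill the
    highest weight vector. *)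
Lemma relideal_ker a :
  relideal (xa K) (@Unbar_le K (-1)) k i a -> uact X a v = 0.
Proof.
case=> s [b [[N [g [_ ->]]] _ ->]]; rewrite [LHS]uactDl.
rewrite [X in X + _](_ : _ = 0); last first.
  rewrite uact_suml; apply: big1 => t _; rewrite uactM; last exact: copXX.
  by rewrite (hw_rel ik dC hv) linear0.
rewrite add0r uactM; last exact: copXX.
rewrite [X in uact _ _ X](_ : _ = 0) ?linear0 // uactXn; last exact: copXX.
rewrite -[RHS](hw_pow ik dC hv); apply: eq_iter => w; exact: uact_xa.
Qed.

End RelidealKernel.

(** ** Spectral flow *)

Section Twist.
Variables (K : numFieldType) (k : nat) (V : lmodType K) (C : currents k V).

(** The automorphism x_{+-alpha}(m) |-> x_{+-alpha}(m -+ 1) of the affine algebra;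
    it shifts h(0) by the level. Twisting the action does the work of a
    translation operator between modules. *)
Definition twist_op (e : sl2_basis) (m : int) (w : V) : V :=
  cop C e (m - chg e) w - ((e == Hcar)%:R * (m == 0)%:R * k%:R) *: w.

Lemma twist_op_linear e m : linear (twist_op e m).
Proof.
move=> a x y; rewrite /twist_op linearP !scalerDr scalerN !scalerA opprD.
by rewrite addrACA mulrC.
Qed.

HB.instance Definition _ e m :=
  GRing.isLinear.Build K V V *:%R (twist_op e m) (twist_op_linear e m).

Let shift_tg e f m n w :
  (br e f)%:~R *: cop C (tg e f) (m - chg e + (n - chg f)) w =
  (br e f)%:~R *: cop C (tg e f) (m + n - chg (tg e f)) w.
Proof.
by case: e f => [] [] /=; rewrite ?scale0r //; congr (_ *: cop C _ _ _); lia.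
Qed.

(* The central terms balance because h(0) is shifted by the level. *)
Let shift_central e f (m n : int) :
  ((m - chg e) * kf e f)%:~R * (m - chg e + (n - chg f) == 0)%:R * k%:R =
  (m * kf e f)%:~R * (m + n == 0)%:R * k%:R
  - (br e f)%:~R * ((tg e f == Hcar)%:R * (m + n == 0)%:R * k%:R) :> K.
Proof.
have -> : (m - chg e + (n - chg f) == 0) = (m + n == chg e + chg f) by lia.
by case: e f => [] [] /=;
  rewrite ?(addr0, add0r, subrr, mulr0, mul0r, mulr1, subr0, intrM) //;
  rewrite ?addrN ?addNr ?intrB ?intrD; ring.
Qed.

Lemma twist_opC e f m n w : twist_op e m (twist_op f n w) =
    twist_op f n (twist_op e m w) + (br e f)%:~R *: twist_op (tg e f) (m + n) w
    + ((m * kf e f)%:~R * (m + n == 0)%:R * k%:R) *: w.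
Proof.
rewrite /twist_op !linearB !linearZ /= copC shift_tg shift_central.
move: (_ * _ * k%:R) => c; move: (_ * _ * k%:R) (_ * _ * k%:R) => a b.
rewrite !scalerN !opprK scalerBl !scalerA [a * (_ * k%:R)]mulrC !addrA.
by rewrite [LHS](ACl (1*6*5*7*2*4*3)).
Qed.

Definition twist : currents k V := Currents twist_opC.

Lemma twistX m w : cop twist Xpos m w = cop C Xpos (m - 1) w.
Proof. by rewrite /= /twist_op /= !mul0r scale0r subr0. Qed.

Lemma twistY m w : cop twist Xneg m w = cop C Xneg (m + 1) w.
Proof. by rewrite /= /twist_op /= !mul0r scale0r subr0 opprK. Qed.

Lemma twistH m w :
  cop twist Hcar m w = cop C Hcar m w - ((m == 0)%:R * k%:R) *: w.
Proof. by rewrite /= /twist_op /= mul1r subr0. Qed.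

Variables (i : nat) (v : V).
Hypotheses (ik : (i <= k)%N) (dC : dominant C) (hv : hw_vector C i v).

(** The end of the string x(-1)^n v is an extremal vector, which the twist turns
    into a highest weight vector of the reflected weight. *)
Lemma twist_hw :
  hw_vector twist (k - i) (iter (k - i) (cop C Xpos (-1)) v).
Proof.
split.
- by apply: hw_pow_neq0 hv _ _.
- by rewrite twistX -iterS -addn1; apply: (hw_pow ik dC hv).
- move=> [] m m0.
  + by rewrite twistY (hw_Ypow ik hv) //; lia.
  + by rewrite twistH (hw_Hpow ik hv) // (gt_eqF m0) mul0r scale0r subr0.
  + by rewrite twistX (hw_Xpow hv) //; lia.
rewrite twistH (hw_H0_iter hv) mul1r -scalerBl; congr (_ *: _).
by rewrite intrD intrM -!pmulrn natrB //; ring.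
Qed.

End Twist.

(** * Vacuum expectations *)

(** The antilinear anti-involution for which the generators of the compact form are
    skew; it reverses the modes. *)
Definition star (e : sl2_basis) : sl2_basis :=
  match e with Xpos => Xneg | Xneg => Xpos | Hcar => Hcar end.

Record unitary (K : numClosedFieldType) (k : nat) (V : lmodType K)
    (C : currents k V) := Unitary {
  form : V -> V -> K;
  form_linl : forall a x y z, form (a *: x + y) z = a^* * form x z + form y z;
  form_linr : forall a x y z, form x (a *: y + z) = a * form x y + form x z;
  form_star : forall e m x y,
    form (cop C e m x) y = form x (cop C (star e) (- m) y);
  form_ge0 : forall x, 0 <= form x x;
  form_eq0 : forall x, form x x = 0 -> x = 0 }.

Section UnitaryTheory.
Variables (K : numClosedFieldType) (k : nat) (V : lmodType K).
Variables (C : currents k V) (U : unitary C).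

Lemma form0l y : form U 0 y = 0.
Proof.
have := form_linl U 1 0 0 y; rewrite scaler0 addr0 conjC1 mul1r => e.
by apply: (addrI (form U 0 y)); rewrite addr0 -e.
Qed.

Lemma form0r y : form U y 0 = 0.
Proof.
have := form_linr U 1 y 0 0; rewrite scaler0 addr0 mul1r => e.
by apply: (addrI (form U y 0)); rewrite addr0 -e.
Qed.

Lemma formZr a x y : form U x (a *: y) = a * form U x y.
Proof. by have := form_linr U a x y 0; rewrite addr0 form0r addr0. Qed.

(** The squared norm of the lowered vector is the weight times the squared norm
    of the vector. *)
Lemma unitary_dominant : dominant C.
Proof.
split=> w l ew hw ll.
- suff e : cop C Xneg 0 w = 0.
    have : l%:~R *: w = 0.
      rewrite -hw; have := copXY C 0 0 w.
      by rewrite e ew !linear0 !mul0r scale0r add0r addr0 addr0 => <-.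
    by move/eqP; rewrite scaler_eq0 intr_eq0 (lt_eqF ll) => /eqP.
  apply: (form_eq0 (u := U)); apply/eqP; rewrite eq_le form_ge0 andbT.
  rewrite form_star oppr0 /= copXY ew linear0 add0r addr0 hw !mul0r scale0r.
  by rewrite addr0 formZr mulr_le0_ge0 ?form_ge0 // lerz0 ltW.
- suff e : cop C Xpos (-1) w = 0.
    have : (k%:Z - l)%:~R *: w = 0.
      have := copYX C 1 (-1) w.
      rewrite e ew !linear0 !mul1r add0r hw => /esym.
      by rewrite intrB scalerBl addrC.
    move/eqP; rewrite scaler_eq0 intr_eq0 subr_eq0 (lt_eqF ll) => /eqP //.
  apply: (form_eq0 (u := U)); apply/eqP; rewrite eq_le form_ge0 andbT.
  rewrite form_star opprK /= copYX ew linear0 add0r subrr hw !mul1r.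
  rewrite addrC -scalerBl formZr mulr_le0_ge0 ?form_ge0 //.
  by rewrite subr_le0 -[k%:R]/(k%:Z%:~R) ler_int ltW.
Qed.

End UnitaryTheory.

(** ** Words in the currents *)

Notation letter := (sl2_basis * int)%type.

Section Words.
Implicit Types (w : seq letter) (a b : letter).

Definition letter_deg a : int * int := (a.2, chg a.1).
Definition word_deg w : int * int := \sum_(a <- w) letter_deg a.

(** The principal degree; it is positive exactly on the raising letters. *)
Definition pdeg (d : int * int) : int := 2 * d.1 + d.2.

Lemma pdegD d e : pdeg (d + e) = pdeg d + pdeg e.
Proof. by rewrite /pdeg /=; ring. Qed.

Lemma pdegN d : pdeg (- d) = - pdeg d.
Proof. by rewrite /pdeg /=; ring. Qed.

Lemma word_deg_cat w1 w2 : word_deg (w1 ++ w2) = word_deg w1 + word_deg w2.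
Proof. exact: big_cat. Qed.

Lemma word_deg_cons a w : word_deg (a :: w) = letter_deg a + word_deg w.
Proof. exact: big_cons. Qed.

Lemma word_deg_nil : word_deg [::] = 0.
Proof. exact: big_nil. Qed.

Definition wact (K : numFieldType) (k : nat) (V : lmodType K)
  (C : currents k V) w (v : V) : V := foldr (fun a => cop C a.1 a.2) v w.

Lemma wact_cat (K : numFieldType) (k : nat) (V : lmodType K)
    (C : currents k V) w1 w2 (v : V) :
  wact C (w1 ++ w2) v = wact C w1 (wact C w2 v).
Proof. exact: foldr_cat. Qed.

Lemma wact_linear (K : numFieldType) (k : nat) (V : lmodType K)
    (C : currents k V) w : linear (@wact K k V C w).
Proof. by move=> c x y; elim: w => //= a w ->; rewrite linearP. Qed.

HB.instance Definition _ (K : numFieldType) (k : nat) (V : lmodType K)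
    (C : currents k V) w :=
  GRing.isLinear.Build K V V *:%R (@wact K k V C w) (wact_linear C w).

(** The scalar c depends on the level and on the weight, but not on the module.
    This is how information passes from one module to another. *)
Definition expectation (K : numFieldType) (k i : nat) w (c : K) : Prop :=
  (forall (V : lmodType K) (C : currents k V) v, hw_vector C i v ->
     wact C w v = c *: v) /\ (word_deg w != 0 -> c = 0).

Definition has_expectation (K : numFieldType) (k i : nat) w : Prop :=
  exists c : K, expectation k i w c.

Section Expectation.
Variables (K : numFieldType) (k i : nat).
Local Notation HE := (@has_expectation K k i).

Section Step.
Variable N : nat.
Hypothesis IH : forall w, (size w < N)%N -> 0 <= pdeg (word_deg w) -> HE w.

(** The bracket terms are shorter words of the same degree. *)
Lemma expectation_swap w1 a b w2 : size (w1 ++ a :: b :: w2) = N ->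
  0 <= pdeg (word_deg (w1 ++ a :: b :: w2)) ->
  HE (w1 ++ b :: a :: w2) -> HE (w1 ++ a :: b :: w2).
Proof.
case: a b => [e m] [f n] sz dg [c [hc c0]].
set w := w1 ++ _ in dg sz *.
pose s : K := (m * kf e f)%:~R * (m + n == 0)%:R * k%:R.
have dswap : word_deg (w1 ++ (f, n) :: (e, m) :: w2) = word_deg w.
  by rewrite /w !word_deg_cat !word_deg_cons [letter_deg (f, n) + _]addrCA.
have [c1 [h1 z1]] : exists c1 : K, (forall V (C : currents k V) v,
    hw_vector C i v -> (br e f)%:~R *: wact C (w1 ++ (tg e f, m + n) :: w2) v
    = c1 *: v) /\ (word_deg w != 0 -> c1 = 0).
  have [br0|br0] := eqVneq (br e f) 0.
    by exists 0; split=> // V C v _; rewrite br0 !scale0r.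
  have dw : word_deg (w1 ++ (tg e f, m + n) :: w2) = word_deg w.
    rewrite /w !word_deg_cat !word_deg_cons; congr (_ + _).
    rewrite addrA; congr (_ + _).
    by rewrite /letter_deg /=; case: e f br0 {s w dg sz dswap hc c0} => [] [].
  have [||c1 [h1 z1]] := IH (w := w1 ++ (tg e f, m + n) :: w2).
  - by rewrite -sz !size_cat /= ltn_add2l.
  - by rewrite dw.
  exists ((br e f)%:~R * c1); split=> [V C v hv|dn].
    by rewrite h1 // scalerA.
  by rewrite z1 ?mulr0 // dw.
have [c2 [h2 z2]] : exists c2 : K, (forall V (C : currents k V) v,
    hw_vector C i v -> s *: wact C (w1 ++ w2) v
    = c2 *: v) /\ (word_deg w != 0 -> c2 = 0).
  have [s0|s0] := eqVneq s 0.
    by exists 0; split=> // V C v _; rewrite s0 !scale0r.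
  have dw : word_deg (w1 ++ w2) = word_deg w.
    rewrite /w !word_deg_cat !word_deg_cons; congr (_ + _); rewrite addrA.
    rewrite (_ : letter_deg _ + letter_deg _ = 0) ?add0r //.
    move: s0; rewrite /s /letter_deg.
    have [mn|] := eqVneq (m + n) 0; last by rewrite mulr0 mul0r eqxx.
    case: e f {s w dg sz dswap hc c0 h1 z1} => [] [] /=;
    by rewrite ?mulr0 ?mul0r ?eqxx // => _; rewrite -[LHS]/(m + n, 0) mn.
  have [||c2 [h2 z2]] := IH (w := w1 ++ w2).
  - by rewrite -sz !size_cat /= !addnS ltnW.
  - by rewrite dw.
  exists (s * c2); split=> [V C v hv|dn]; first by rewrite h2 // scalerA.
  by rewrite z2 ?mulr0 // dw.
exists (c + c1 + c2); split=> [V C v hv|dn]; last first.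
  by rewrite c0 ?dswap // z1 // z2 // !addr0.
rewrite !scalerDl -(hc V C v hv) -(h1 V C v hv) -(h2 V C v hv).
by rewrite /w !wact_cat /= copC !linearD !linearZ.
Qed.

Lemma expectation_move w1 a w2 : size (w1 ++ a :: w2) = N ->
  0 <= pdeg (word_deg (w1 ++ a :: w2)) ->
  HE (w1 ++ w2 ++ [:: a]) -> HE (w1 ++ a :: w2).
Proof.
elim: w2 w1 => [|b w2 IHw] w1 sz dg //= hE.
apply: expectation_swap => //; rewrite -cat_rcons; apply: IHw.
- by rewrite -sz cat_rcons !size_cat.
- rewrite cat_rcons; move: dg; rewrite !word_deg_cat !word_deg_cons.
  by rewrite (addrCA (letter_deg b) (letter_deg a)).
by rewrite cat_rcons.
Qed.

End Step.

Lemma pdeg_neg_word w : (forall a, a \in w -> pdeg (letter_deg a) < 0) ->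
  0 <= pdeg (word_deg w) -> w = [::].
Proof.
case: w => // a w neg; rewrite leNgt word_deg_cons pdegD => /negP[].
have: pdeg (word_deg w) <= 0.
  elim: w neg => [|b w IHw] neg; first by rewrite word_deg_nil.
  have hb : pdeg (letter_deg b) < 0 by apply: neg; rewrite !inE eqxx orbT.
  have hw : pdeg (word_deg w) <= 0.
    by apply: IHw => c; rewrite inE => /orP[] cw; apply: neg;
      rewrite !inE cw ?orbT.
  by rewrite word_deg_cons pdegD; lia.
have := neg a (mem_head _ _); lia.
Qed.

(** The letters of nonnegative principal degree span the Borel subalgebra. *)
Lemma pdeg_ge0_letter a : 0 <= pdeg (letter_deg a) ->
  a = (Hcar, 0) \/ forall (V : lmodType K) (C : currents k V) v,
    hw_vector C i v -> cop C a.1 a.2 v = 0.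
Proof.
case: a => [] [] m; rewrite /pdeg /letter_deg /=.
- by move=> m0; right=> V C v hv; apply: (hw_pos hv); lia.
- case: (ltrgt0P m) => [m0|m0|->]; [|by lia|by left].
  by right=> V C v hv; apply: (hw_pos hv).
- by move=> m0; right=> V C v hv; apply: (hw_X hv); lia.
Qed.

(** A word of nonnegative degree is empty or has a letter in the Borel subalgebra;
    that letter is moved to the right, where it acts by a scalar. *)
Lemma expectation_exists w : 0 <= pdeg (word_deg w) -> HE w.
Proof.
move: {2}(size w).+1 (ltnSn (size w)) => N; elim: N w => // N IH w sz dg.
have IH' w' : (size w' < size w)%N -> 0 <= pdeg (word_deg w') -> HE w'.
  by move=> sw; apply: IH; apply: leq_trans sw _.
have [/hasP[a aw a0]|/hasPn neg] :=
    boolP (has (fun a => 0 <= pdeg (letter_deg a)) w); last first.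
  rewrite (@pdeg_neg_word w) //; last by move=> a /neg; rewrite -ltNge.
  by exists 1; split=> [V C v _|]; rewrite ?scale1r // word_deg_nil eqxx.
case/splitPr: aw sz dg IH' => w1 w2 sz dg IH'.
apply: (expectation_move IH') => //.
have [aH|a_kills] := pdeg_ge0_letter a0; last first.
  exists 0; split=> // V C v hv.
  by rewrite !wact_cat /= a_kills // !linear0 scale0r.
have dw : word_deg (w1 ++ w2) = word_deg (w1 ++ a :: w2).
  by rewrite !word_deg_cat word_deg_cons aH add0r.
have [||c [hc c0]] := IH' (w1 ++ w2).
- by rewrite !size_cat /= addnS.
- by rewrite dw.
exists (c * i%:R); split=> [V C v hv|].
  rewrite aH !wact_cat /= (hw_H0 hv) !linearZ /= -scalerA.
  by rewrite -wact_cat hc // !scalerA mulrC.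
rewrite catA word_deg_cat word_deg_cons word_deg_nil addr0 aH => dn.
by rewrite c0 ?mul0r // -[word_deg _]addr0.
Qed.

End Expectation.
End Words.

(** ** Annihilators in unitary modules *)

Section MonomialWords.
Implicit Types (u : {cmonom int}) (w : seq letter).

(** Bidegree of a variable: energy and charge. *)
Definition xwt (m : int) : int * int := (m, 1).

Definition mword u : seq letter :=
  flatten [seq nseq (u m) (Xpos, m) | m <- finsupp u].

Definition dag w : seq letter := rev [seq (star a.1, - a.2) | a <- w].

Lemma mact_word (K : numFieldType) (k : nat) (V : lmodType K)
    (C : currents k V) u v : mact (cop C Xpos) u v = wact C (mword u) v.
Proof.
rewrite /mact /mword; elim: (enum_fset _) => //= m s ->.
by rewrite wact_cat; elim: (u m) => //= n ->.
Qed.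

Lemma word_deg_mword u : word_deg (mword u) = deg xwt u.
Proof.
rewrite /mword /deg; elim: (enum_fset _) => [|m s IH].
  by rewrite word_deg_nil big_nil.
rewrite /= word_deg_cat IH big_cons; congr (_ + _).
by elim: (u m) => [|n IHn]; rewrite ?word_deg_nil //= word_deg_cons IHn mulrS.
Qed.

Lemma word_deg_dag w : word_deg (dag w) = - word_deg w.
Proof.
rewrite /dag; elim: w => [|a w IH]; first by rewrite word_deg_nil oppr0.
rewrite /= rev_cons -cats1 word_deg_cat IH !word_deg_cons word_deg_nil addr0.
by rewrite addrC opprD; congr (_ + _); case: a => [] [].
Qed.

(** A matrix coefficient between two words is the expectation of a single word. *)
Lemma form_dag (K : numClosedFieldType) (k : nat) (V : lmodType K)
    (C : currents k V) (U : unitary C) w x y :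
  form U (wact C w x) y = form U x (wact C (dag w) y).
Proof.
elim: w x y => //= a w IH x y.
by rewrite form_star IH /dag /= rev_cons -cats1 wact_cat.
Qed.

End MonomialWords.

Section UnitaryKernel.
Variables (K : numClosedFieldType) (k i : nat).
Variables (V1 V2 : lmodType K) (C1 : currents k V1) (C2 : currents k V2).
Variables (v1 : V1) (v2 : V2).
Hypotheses (hv1 : hw_vector C1 i v1) (hv2 : hw_vector C2 i v2).

Let same_expectation w d a :
  word_deg w = - d -> all_supp (fun u => pdeg d <= pdeg (deg xwt u)) a ->
  exists s : K, wact C1 w (uact (cop C1 Xpos) a v1) = s *: v1 /\
    wact C2 w (uact (cop C2 Xpos) (proj xwt d a) v2) = s *: v2.
Proof.
move=> dw; move: a; apply: all_supp_ind => [|a b [s [s1 s2]] [t [t1 t2]]|c u du].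
- exists 0; rewrite !scale0r; split; first by rewrite uact0l [LHS]linear0.
  by rewrite proj0 uact0l [LHS]linear0.
- exists (s + t); rewrite !scalerDl; split.
    by rewrite uactDl [LHS]linearD; apply: congr2; [exact: s1|exact: t1].
  by rewrite projD uactDl [LHS]linearD; apply: congr2; [exact: s2|exact: t2].
have [|e [he e0]] := @expectation_exists K k i (w ++ mword u).
  by rewrite word_deg_cat dw word_deg_mword pdegD pdegN addrC subr_ge0.
exists (c * e); rewrite -!scalerA; split.
  rewrite uactZl [LHS]linearZ; congr (_ *: _).
  rewrite uactU mact_word.
  exact: etrans (esym (wact_cat _ _ _ _)) (he _ _ _ hv1).
rewrite projZ uactZl [LHS]linearZ; congr (_ *: _); rewrite projU.
have [du'|du'] := eqVneq (deg xwt u) d.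
  rewrite uactU mact_word.
  exact: etrans (esym (wact_cat _ _ _ _)) (he _ _ _ hv2).
rewrite e0 ?scale0r; first by rewrite uact0l [LHS]linear0.
by rewrite word_deg_cat dw word_deg_mword addrC subr_eq0.
Qed.

(** Let z be the image of the second vector under the component of degree d of a.
    The form of z with any vector in the same degree is an expectation, so it can
    be computed with a on the first vector, which a kills: the other
    components of a contribute nothing because the degrees do not match. In
    particular the form of z with itself vanishes. *)
Lemma unitary_kernel (U : unitary C2) d a :
  all_supp (fun u => pdeg d <= pdeg (deg xwt u)) a ->
  uact (cop C1 Xpos) a v1 = 0 -> uact (cop C2 Xpos) (proj xwt d a) v2 = 0.
Proof.
move=> da a0; apply: (form_eq0 (u := U)).
set z := uact _ _ _; have : homog xwt d (proj xwt d a) by apply: proj_homog.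
suff zero b : homog xwt d b -> form U (uact (cop C2 Xpos) b v2) z = 0.
  by move/zero.
move: b; apply: all_supp_ind => [|b b' h h'|c u du].
- by rewrite uact0l form0l.
- by rewrite uactDl -[uact _ b _]scale1r form_linl h h' mulr0 addr0.
rewrite uactZl -[_ *: _]addr0 form_linl form0l addr0.
rewrite uactU mact_word form_dag.
have dw : word_deg (dag (mword u)) = - d by rewrite word_deg_dag word_deg_mword du.
have [s [s1 s2]] := same_expectation dw da.
move: s1; rewrite a0 linear0 => /esym/eqP.
rewrite scaler_eq0 (negbTE (hw_neq0 hv1)) orbF => /eqP s0.
by rewrite /z s2 s0 scale0r form0r mulr0.
Qed.

End UnitaryKernel.

(** * The fermionic Fock space *)

Section Clifford.
Variables (K : numClosedFieldType) (I : countType).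
Local Notation F := {malg K[{fset I}]}.
Implicit Types (p q : I) (S T : {fset I}) (w x y : F).

(** The Jordan-Wigner sign jw counts the modes of S that precede p, for the order
    given by the enumeration of the modes; it makes the operators of different
    modes anticommute. *)
Definition ncross p S : nat := \sum_(q <- S) (choice.pickle q < choice.pickle p)%N.
Definition jw p S : K := (-1) ^+ ncross p S.

Lemma jwU1 p q S : q \notin S ->
  jw p (q |` S)%fset = (-1) ^+ (choice.pickle q < choice.pickle p)%N * jw p S.
Proof. by move=> qS; rewrite /jw /ncross big_fsetU1 // exprD. Qed.

Lemma jwD1 p q S : q \in S ->
  jw p S = (-1) ^+ (choice.pickle q < choice.pickle p)%N * jw p (S `\ q)%fset.
Proof. by move=> qS; rewrite /jw /ncross (big_fsetD1 q) // exprD. Qed.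

Lemma jw_sqr p S : jw p S * jw p S = 1.
Proof. by rewrite -expr2 sqrr_sign. Qed.

Lemma jwU1p p S : p \notin S -> jw p (p |` S)%fset = jw p S.
Proof. by move=> pS; rewrite jwU1 // ltnn mul1r. Qed.

Lemma jwD1p p S : p \in S -> jw p (S `\ p)%fset = jw p S.
Proof. by move=> pS; rewrite [RHS](jwD1 p pS) ltnn mul1r. Qed.

Lemma sign_cross p q : p != q ->
  (-1) ^+ (choice.pickle q < choice.pickle p)%N =
  - (-1) ^+ (choice.pickle p < choice.pickle q)%N :> K.
Proof.
move=> pq; case: ltngtP => h; rewrite ?expr0 ?expr1 ?opprK //.
by case/eqP: pq; apply: (pcan_inj choice.pickleK).
Qed.

(** Creation and annihilation operators on the span of the finite sets of modes. *)
Definition cr p : F -> F :=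
  lext (fun S => if p \in S then 0 else jw p S *: << (p |` S)%fset >>).
Definition an p : F -> F :=
  lext (fun S => if p \in S then jw p S *: << (S `\ p)%fset >> else 0).

HB.instance Definition _ p :=
  GRing.isLinear.Build K F F *:%R (cr p) (lext_is_linear _).
HB.instance Definition _ p :=
  GRing.isLinear.Build K F F *:%R (an p) (lext_is_linear _).

Lemma crU p S :
  cr p << S >> = if p \in S then 0 else jw p S *: << (p |` S)%fset >>.
Proof. exact: lextU. Qed.

Lemma anU p S :
  an p << S >> = if p \in S then jw p S *: << (S `\ p)%fset >> else 0.
Proof. exact: lextU. Qed.

Lemma crU0 p S : p \in S -> cr p << S >> = 0.
Proof. by move=> pS; rewrite crU pS. Qed.

Lemma crU1 p S : p \notin S -> cr p << S >> = jw p S *: << (p |` S)%fset >>.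
Proof. by move=> pS; rewrite crU (negbTE pS). Qed.

Lemma anU0 p S : p \notin S -> an p << S >> = 0.
Proof. by move=> pS; rewrite anU (negbTE pS). Qed.

Lemma anU1 p S : p \in S -> an p << S >> = jw p S *: << (S `\ p)%fset >>.
Proof. by move=> pS; rewrite anU pS. Qed.

Lemma crcrU p q S : p != q -> p \notin S -> q \notin S ->
  cr p (cr q << S >>) =
  ((-1) ^+ (choice.pickle q < choice.pickle p)%N * jw p S * jw q S)
    *: << (p |` (q |` S))%fset >>.
Proof.
move=> pq pS qS; rewrite crU1 // linearZ /= crU1; last first.
  by rewrite in_fset1U (negbTE pq) (negbTE pS).
by rewrite scalerA [jw q S * _]mulrC jwU1.
Qed.

Lemma cr_cr p q w : cr p (cr q w) = - cr q (cr p w).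
Proof.
move: w; apply: (linear_eq (g := cr p \o cr q) (h := \- (cr q \o cr p))) => S /=.
have [<-|pq] := eqVneq p q.
  have [pS|pS] := boolP (p \in S); first by rewrite crU0 // linear0 oppr0.
  by rewrite crU1 // linearZ /= crU0 ?scaler0 ?oppr0 // in_fset1U eqxx.
have [pS|pS] := boolP (p \in S).
  rewrite [cr p << S >>]crU0 // linear0 oppr0.
  have [qS|qS] := boolP (q \in S); first by rewrite crU0 // linear0.
  by rewrite crU1 // linearZ /= crU0 ?scaler0 // in_fset1U pS orbT.
have [qS|qS] := boolP (q \in S).
  rewrite [cr q << S >>]crU0 // linear0 crU1 // linearZ /= crU0 ?scaler0 ?oppr0 //.
  by rewrite in_fset1U qS orbT.
rewrite crcrU // crcrU 1?eq_sym // fsetUCA -scaleNr; congr (_ *: _).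
by rewrite (sign_cross pq); ring.
Qed.

Lemma ananU p q S : p != q -> p \in S -> q \in S ->
  an p (an q << S >>) =
  ((-1) ^+ (choice.pickle q < choice.pickle p)%N * jw p S * jw q S)
    *: << (S `\ q `\ p)%fset >>.
Proof.
move=> pq pS qS; rewrite anU1 // linearZ /= anU1; last first.
  by rewrite in_fsetD1 pq pS.
rewrite scalerA; congr (_ *: _); rewrite [X in _ = _ * X * _](jwD1 p qS).
by rewrite mulrA -expr2 sqrr_sign mul1r mulrC.
Qed.

Lemma an_an p q w : an p (an q w) = - an q (an p w).
Proof.
move: w; apply: (linear_eq (g := an p \o an q) (h := \- (an q \o an p))) => S /=.
have [<-|pq] := eqVneq p q.
  have [pS|pS] := boolP (p \in S); last by rewrite anU0 // linear0 oppr0.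
  by rewrite anU1 // linearZ /= anU0 ?scaler0 ?oppr0 // in_fsetD1 eqxx.
have [pS|pS] := boolP (p \in S); last first.
  rewrite [an p << S >>]anU0 // linear0 oppr0.
  have [qS|qS] := boolP (q \in S); last by rewrite anU0 // linear0.
  by rewrite anU1 // linearZ /= anU0 ?scaler0 // in_fsetD1 negb_and pS orbT.
have [qS|qS] := boolP (q \in S); last first.
  rewrite [an q << S >>]anU0 // linear0 anU1 // linearZ /= anU0 ?scaler0 ?oppr0 //.
  by rewrite in_fsetD1 negb_and qS orbT.
rewrite ananU // ananU 1?eq_sym // -scaleNr.
have -> : (S `\ q `\ p = S `\ p `\ q)%fset by rewrite !fsetDDl fsetUC.
by congr (_ *: _); rewrite (sign_cross pq); ring.
Qed.

Lemma an_cr p q w : an p (cr q w) = (p == q)%:R *: w - cr q (an p w).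
Proof.
move: w; apply: (linear_eq (g := an p \o cr q)
   (h := (p == q)%:R \*: idfun \- (cr q \o an p))) => S /=.
have [<-|pq] := eqVneq p q.
  rewrite scale1r; have [pS|pS] := boolP (p \in S).
    rewrite crU0 // linear0 anU1 // linearZ /= crU1 ?in_fsetD1 ?eqxx //.
    by rewrite scalerA jwD1p // jw_sqr scale1r fsetD1K // subrr.
  rewrite crU1 // linearZ /= anU1 ?in_fset1U ?eqxx // scalerA jwU1p //.
  by rewrite jw_sqr scale1r anU0 // linear0 subr0 fsetU1K.
rewrite scale0r sub0r; have [pS|pS] := boolP (p \in S); last first.
  rewrite [an p << S >>]anU0 // linear0 oppr0.
  have [qS|qS] := boolP (q \in S); first by rewrite crU0 // linear0.
  by rewrite crU1 // linearZ /= anU0 ?scaler0 // in_fset1U negb_or pq pS.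
have [qS|qS] := boolP (q \in S).
  rewrite crU0 // linear0 anU1 // linearZ /= crU0 ?scaler0 ?oppr0 //.
  by rewrite in_fsetD1 eq_sym pq qS.
rewrite crU1 // linearZ /= anU1 ?in_fset1U ?pS ?orbT //.
rewrite [an p << S >>]anU1 // [cr q _]linearZ /= crU1; last first.
  by rewrite in_fsetD1 negb_and qS orbT.
rewrite !scalerA -scaleNr.
have -> : ((q |` S) `\ p = q |` (S `\ p))%fset.
  apply/fsetP => r; rewrite !inE; have [->|] := eqVneq r p; last by [].
  by rewrite (negbTE pq).
congr (_ *: _); rewrite jwU1 // [jw q S](jwD1 q pS) (sign_cross pq).
set s := (-1) ^+ (choice.pickle p < choice.pickle q)%N.
have ss : s * s = 1 by rewrite -expr2 sqrr_sign.
by rewrite -[RHS]mul1r -ss; ring.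
Qed.

End Clifford.

(** ** The Hermitian form *)

Section CliffordForm.
Variables (K : numClosedFieldType) (I : countType).
Local Notation F := {malg K[{fset I}]}.
Implicit Types (p q : I) (S T : {fset I}) (w x y : F).

(** The Hermitian form for which the states are orthonormal. *)
Definition fform x y : K := \sum_(S <- msupp x) (x@_S)^* * y@_S.

Lemma fformEw (d : {fset {fset I}}) x y :
  (msupp x `<=` d)%fset -> fform x y = \sum_(S <- d) (x@_S)^* * y@_S.
Proof.
move=> le; rewrite /fform (big_fset_incl _ le) // => S _ /mcoeff_outdom ->.
by rewrite conjC0 mul0r.
Qed.

Lemma fform_linl a x y z : fform (a *: x + y) z = a^* * fform x z + fform y z.
Proof.
have le1 : (msupp (a *: x + y) `<=` msupp x `|` msupp y)%fset.
  apply: fsubset_trans (msuppD_le _ _) _; apply: fsetSU; exact: msuppZ_le.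
rewrite (fformEw _ le1) (fformEw _ (fsubsetUl (msupp x) (msupp y))).
rewrite (fformEw _ (fsubsetUr (msupp x) (msupp y))) mulr_sumr -big_split /=.
apply: eq_bigr => S _; rewrite mcoeffD mcoeffZ rmorphD rmorphM /=.
by rewrite mulrDl mulrA.
Qed.

Lemma fform_linr a x y z : fform x (a *: y + z) = a * fform x y + fform x z.
Proof.
rewrite /fform mulr_sumr -big_split /=; apply: eq_bigr => S _.
by rewrite mcoeffD mcoeffZ mulrDr mulrCA.
Qed.

Lemma fform_ge0 x : 0 <= fform x x.
Proof.
by apply: sumr_ge0 => S _; rewrite mulrC -normCK exprn_ge0.
Qed.

Lemma fform_eq0 x : fform x x = 0 -> x = 0.
Proof.
move/eqP; rewrite psumr_eq0 => [/allP x0|S _]; last first.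
  by rewrite mulrC -normCK exprn_ge0.
apply/malgP => S; rewrite mcoeff0; have [Sx|/mcoeff_outdom //] := boolP (S \in msupp x).
by have := x0 S Sx; rewrite mulrC -normCK expf_eq0 /= normr_eq0 => /eqP.
Qed.

Lemma fform0l y : fform 0 y = 0.
Proof. by rewrite /fform msupp0 big_seq_fset0. Qed.

Lemma fformDl x y z : fform (x + y) z = fform x z + fform y z.
Proof. by rewrite -{1}[x]scale1r fform_linl conjC1 mul1r. Qed.

Lemma fformZl a x z : fform (a *: x) z = a^* * fform x z.
Proof. by rewrite -{1}[a *: x]addr0 fform_linl fform0l addr0. Qed.

Lemma fformC x y : fform x y = (fform y x)^*.
Proof.
rewrite (fformEw _ (fsubsetUl (msupp x) (msupp y))).
rewrite [fform y x](fformEw _ (fsubsetUr (msupp x) (msupp y))) rmorph_sum.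
by apply: eq_bigr => S _; rewrite rmorphM /= conjCK mulrC.
Qed.

Lemma fformU S y : fform << S >> y = y@_S.
Proof.
by rewrite /fform msuppU oner_eq0 big_seq_fset1 mcoeffUU conjC1 mul1r.
Qed.

Lemma jwC p S : (jw K p S)^* = jw K p S.
Proof. by rewrite /jw rmorphXn rmorphN rmorph1. Qed.

Lemma mcoeff_an p S y :
  (an p y)@_S = if p \in S then 0 else jw K p S * y@_(p |` S)%fset.
Proof.
move: y; apply: malg_ind => [|x y hx hy|c T].
- by rewrite linear0 !mcoeff0 mulr0 if_same.
- by rewrite linearD !mcoeffD hx hy; case: ifP; rewrite ?addr0 // mulrDr.
rewrite linearZ !mcoeffZ /= mulrCA -[if _ then _ else _]/(_).
have [pT|pT] := boolP (p \in T); last first.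
  rewrite anU0 // mcoeff0 mulr0; case: ifP => // _; rewrite mcoeffU.
  have [e|] := eqVneq T _; last by rewrite !mulr0.
  by rewrite e in_fset1U eqxx in pT.
rewrite anU1 // mcoeffZ !mcoeffU; have [<-|TS] := eqVneq (T `\ p)%fset S.
  by rewrite in_fsetD1 eqxx /= fsetD1K // eqxx jwD1p.
rewrite !mulr0; case: ifP => // /negbT pS; have [e|] := eqVneq T _.
  by case/eqP: TS; rewrite e fsetU1K.
by rewrite !mulr0.
Qed.

(** The states << S >> are orthonormal, and cr p and an p are transposed
    signed partial permutations of them. *)
Lemma fform_cr p x y : fform (cr p x) y = fform x (an p y).
Proof.
move: x; apply: malg_ind => [|x x' hx hx'|c S].
- by rewrite linear0 !fform0l.
- by rewrite linearD !fformDl hx hx'.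
rewrite [cr p _]linearZ [LHS]fformZl [RHS]fformZl; congr (_ * _) => /=.
rewrite [RHS]fformU mcoeff_an.
have [pS|pS] := boolP (p \in S); first by rewrite crU0 ?fform0l.
by rewrite crU1 // fformZl fformU jwC.
Qed.

Lemma fform_an p x y : fform (an p x) y = fform x (cr p y).
Proof. by rewrite fformC -fform_cr -fformC. Qed.

(** ** The fermions relative to a filled set of modes *)

Variable sea : pred I.

(** Exchanging creation and annihilation on the modes of the sea makes the vacuum
    the state in which these modes are filled, although no infinite set occurs. *)
Definition psi p : {linear F -> F} := if sea p then (an p : {linear F -> F}) else cr p.
Definition psis p : {linear F -> F} := if sea p then (cr p : {linear F -> F}) else an p.

Lemma fform_psi p x y : fform (psi p x) y = fform x (psis p y).
Proof. by rewrite /psi /psis; case: (sea p); rewrite ?fform_cr ?fform_an. Qed.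

Lemma fform_psis p x y : fform (psis p x) y = fform x (psi p y).
Proof. by rewrite /psi /psis; case: (sea p); rewrite ?fform_cr ?fform_an. Qed.

Lemma cr_an p q w : cr p (an q w) = (p == q)%:R *: w - an q (cr p w).
Proof. by rewrite an_cr eq_sym opprB addrC subrK. Qed.

Lemma psi_psi p q w : psi p (psi q w) = - psi q (psi p w).
Proof.
rewrite /psi; case sp: (sea p); case sq: (sea q) => /=.
- exact: an_an.
- rewrite an_cr (_ : (p == q) = false) ?scale0r ?sub0r //.
  by apply: contraFF sq => /eqP <-.
- rewrite cr_an (_ : (p == q) = false) ?scale0r ?sub0r //.
  by apply: contraFF sp => /eqP ->.
- exact: cr_cr.
Qed.

Lemma psis_psis p q w : psis p (psis q w) = - psis q (psis p w).
Proof.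
rewrite /psis; case sp: (sea p); case sq: (sea q) => /=.
- exact: cr_cr.
- rewrite cr_an (_ : (p == q) = false) ?scale0r ?sub0r //.
  by apply: contraFF sq => /eqP <-.
- rewrite an_cr (_ : (p == q) = false) ?scale0r ?sub0r //.
  by apply: contraFF sp => /eqP ->.
- exact: an_an.
Qed.

Lemma psi_psis p q w : psi p (psis q w) = (p == q)%:R *: w - psis q (psi p w).
Proof.
rewrite /psi /psis; case sp: (sea p); case sq: (sea q) => /=.
- exact: an_cr.
- rewrite an_an (_ : (p == q) = false) ?scale0r ?sub0r //.
  by apply: contraFF sq => /eqP <-.
- rewrite cr_cr (_ : (p == q) = false) ?scale0r ?sub0r //.
  by apply: contraFF sp => /eqP ->.
- exact: cr_an.
Qed.

Lemma psis_psi p q w : psis p (psi q w) = (p == q)%:R *: w - psi q (psis p w).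
Proof. by rewrite psi_psis eq_sym opprB addrC subrK. Qed.

Definition vac : F := << fset0 >>.

Lemma an_vac p : an p vac = 0.
Proof. by rewrite anU0 // in_fset0. Qed.

Lemma vac_neq0 : vac != 0.
Proof. by rewrite monalgU_eq0 oner_eq0. Qed.

Lemma an_supp p w : (forall S, S \in msupp w -> p \notin S) -> an p w = 0.
Proof.
move=> pw; rewrite [w]malg_sumU linear_sum big_seq big1 // => S /pw pS.
by rewrite linearZ /= anU0 // scaler0.
Qed.

End CliffordForm.

(** ** Bilinears in the fermions *)

Fact add_subsub (V : zmodType) (a b y : V) : a + y - (b - y) = a - b + (y + y).
Proof. by rewrite opprB !addrA [RHS](ACl (1*3*4*2)). Qed.

Fact sub_subadd (V : zmodType) (a b y : V) :
  a - y - (b + y) = a - b + (- y - y).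
Proof. by rewrite opprD !addrA [LHS](ACl (1*3*2*4)). Qed.

Fact sub_sub_central (V : zmodType) (a b c d z : V) :
  a + z - b - (c - (d + z)) = a - c - (b - d) + (z + z).
Proof. by rewrite !opprB !addrA [LHS](ACl (1*6*4*3*2*5)). Qed.

Section Fock.
Variables (K : numClosedFieldType) (V : lmodType K) (k : nat).

(** A mode is a copy of C^2 (true for the first basis vector), a colour and a
    power of t; the modes with a nonnegative power are filled. *)
Local Notation fmode := (bool * nat * int)%type.

Variables (fpsi fpsis : fmode -> {linear V -> V}) (fbound : V -> nat).
Local Notation psi a c r := (fpsi (a, (c : nat), r)).
Local Notation psis a c r := (fpsis (a, (c : nat), r)).
Hypothesis psi_psi : forall p q w, fpsi p (fpsi q w) = - fpsi q (fpsi p w).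
Hypothesis psis_psis : forall p q w, fpsis p (fpsis q w) = - fpsis q (fpsis p w).
Hypothesis psi_psis : forall p q w,
  fpsi p (fpsis q w) = (p == q)%:R *: w - fpsis q (fpsi p w).
Let psis_psi p q w :
  fpsis p (fpsi q w) = (p == q)%:R *: w - fpsi q (fpsis p w).
Proof. by rewrite psi_psis eq_sym opprB addrC subrK. Qed.

Hypothesis psi_far : forall p w,
  (fbound w)%:Z <= p.2 -> fpsi p w = 0.
Hypothesis psis_far : forall p w,
  p.2 < 0 -> (fbound w)%:Z <= - p.2 -> fpsis p w = 0.

Section Bilinear.
Variables (a b : bool) (m : int).

Definition tr (A : int) (n : nat) (w : V) : V :=
  \sum_(c < k) \sum_(j < n) psi a c (A + j%:Z + m) (psis b c (A + j%:Z) w).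

Definition kap : K := ((a == b) && (m == 0))%:R.

(** The cut-off sum, minus the number of filled pairs below the cut-off. *)
Definition norm_tr (A : int) (n : nat) (w : V) : V :=
  tr A n w - (k%:R * (A + n%:Z)%:~R * kap) *: w.

Lemma tr_linear A n : linear (tr A n).
Proof.
move=> c x y; rewrite /tr scaler_sumr -big_split; apply: eq_bigr => d _ /=.
rewrite scaler_sumr -big_split; apply: eq_bigr => j _ /=.
by rewrite [psis _ _ _ _]linearP [LHS]linearP.
Qed.

HB.instance Definition _ A n :=
  GRing.isLinear.Build K V V *:%R (tr A n) (tr_linear A n).

Section Stable.
Variable w : V.
Let B := (fbound w + `|m|)%N.

Let trL A n : A <= - B%:Z -> tr (A - 1) n.+1 w = tr A n w.
Proof.
move=> AB; apply: eq_bigr => c _; rewrite big_ord_recl.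
rewrite [X in X + _](_ : _ = 0) ?add0r.
  apply: eq_bigr => j _; congr (psi _ _ _ (psis _ _ _ _)); rewrite /= /bump; lia.
rewrite [psis _ _ _ _](_ : _ = 0) ?linear0 //.
by apply: psis_far => /=; rewrite /B in AB; lia.
Qed.

Let trR A n : B%:Z <= A + n%:Z ->
  tr A n.+1 w = tr A n w + (k%:R * kap) *: w.
Proof.
move=> AB; rewrite /tr; under eq_bigr => c _ do rewrite big_ord_recr /=.
rewrite big_split /=; congr (_ + _).
rewrite -scalerA scaler_nat -[X in _ *+ X]card_ord -sumr_const.
apply: eq_bigr => c _; rewrite psi_psis.
rewrite (_ : (_ == _) = (a == b) && (m == 0)); last first.
  rewrite !xpair_eqE eqxx andbT; congr (_ && _); lia.
rewrite [psi _ _ _ _](_ : _ = 0) ?linear0 ?oppr0 ?addr0 //.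
by apply: psi_far => /=; rewrite /B in AB; lia.
Qed.

Let normL A n x : A <= - B%:Z ->
  norm_tr (A - x%:Z) (n + x) w = norm_tr A n w.
Proof.
elim: x => [|x IH] AB; first by rewrite subr0 addn0.
rewrite -IH // /norm_tr addnS (_ : A - x.+1%:Z = A - x%:Z - 1); last by lia.
rewrite trL; last by lia.
by congr (_ - (_ * _%:~R * _) *: _); lia.
Qed.

Let normR A n y : B%:Z <= A + n%:Z ->
  norm_tr A (n + y) w = norm_tr A n w.
Proof.
elim: y => [|y IH] AB; first by rewrite addn0.
rewrite -IH // /norm_tr addnS trR; last by lia.
rewrite -addrA; congr (_ + _); rewrite -scalerBl -scaleNr; congr (_ *: _).
rewrite (_ : (A + (n + y).+1%:Z) = A + (n + y)%:Z + 1); last by lia.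
by rewrite intrD; ring.
Qed.

(** The normally ordered sum over all colours c and all s of the operators
    psi(a, c, s + m) psis(b, c, s). On a given vector the truncated sums only change
    by the number of filled pairs, so that the normalised sum is eventually
    constant. The lock keeps conversion from unfolding it. *)
Definition bil : V := locked (norm_tr (- B%:Z) (B + B) w).

Lemma tr_bil : exists N : nat, forall A n, A <= - N%:Z -> N%:Z <= A + n%:Z ->
  tr A n w = bil + (k%:R * (A + n%:Z)%:~R * kap) *: w.
Proof.
exists B => A n AB ABn; rewrite -[LHS](subrK ((k%:R * (A + n%:Z)%:~R * kap) *: w)).
congr (_ + _); rewrite -/(norm_tr A n w) /bil -lock.
have [x ex] : exists x : nat, A = - B%:Z - x%:Z.
  by exists `|- B%:Z - A|%N; lia.
have [y ey] : exists y : nat, n = (B + B + y + x)%N.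
  by exists (n - (B + B + x))%N; lia.
by rewrite ey ex normL // normR //; lia.
Qed.

End Stable.

Lemma bil_uniq w u N : (forall A n, A <= - N%:Z -> N%:Z <= A + n%:Z ->
  tr A n w = u + (k%:R * (A + n%:Z)%:~R * kap) *: w) -> bil w = u.
Proof.
have [N' hN'] := tr_bil w; move=> hN.
have := hN (- (N + N')%:Z) (2 * (N + N'))%N; rewrite hN'; try lia.
by move=> /(_ _ _)/addIr; apply; lia.
Qed.

Lemma bil_linear : linear bil.
Proof.
move=> c x y; have [N1 h1] := tr_bil x; have [N2 h2] := tr_bil y.
apply: (@bil_uniq _ _ (maxn N1 N2)) => A n An1 An2.
rewrite tr_linear h1; [|lia|lia]; rewrite h2; [|lia|lia].
rewrite !scalerDr !scalerA addrACA; congr (_ + (_ *: _ + _)).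
by rewrite mulrC.
Qed.

HB.instance Definition _ := GRing.isLinear.Build K V V *:%R bil bil_linear.

Let delta_sum A n (G : nat -> int -> V) c r : A <= r -> r < A + n%:Z ->
  \sum_(d < k) \sum_(j < n) ((d == c :> nat) && (A + j%:Z == r))%:R *:
    G d (A + j%:Z) = (c < k)%N%:R *: G c r.
Proof.
move=> Ar rA; have jn : (`|(r - A)%R|%N < n)%N by lia.
have jE : A + (`|(r - A)%R|%N)%:Z = r by lia.
case: (ltnP c k) => ck; last first.
  rewrite scale0r big1 // => d _; rewrite big1 // => j _.
  by rewrite ltn_eqF ?scale0r // (leq_trans (ltn_ord d)).
rewrite (bigD1 (Ordinal ck)) //= (bigD1 (Ordinal jn)) //= jE !eqxx /=.
rewrite [X in _ + X + _]big1 => [|j /eqP nj].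
  rewrite [X in _ + X]big1 ?addr0 // => d /eqP nd; apply: big1 => j _.
  rewrite (_ : (_ == _) = false) ?scale0r //.
  by apply/eqP => e; apply: nd; apply: val_inj.
rewrite (_ : (_ == _) = false) ?scale0r //.
by apply/eqP => e; apply: nj; apply: val_inj => /=; lia.
Qed.

Lemma bil_psi d c r w : bil (psi d c r w) =
  psi d c r (bil w) + ((b == d) && (c < k)%N)%:R *: psi a c (r + m) w.
Proof.
have [N h] := tr_bil w.
apply: (@bil_uniq _ _ (N + `|r|.+1)) => A n An1 An2.
have -> : tr A n (psi d c r w) =
   psi d c r (tr A n w) + ((b == d) && (c < k)%N)%:R *: psi a c (r + m) w.
  have -> : ((b == d) && (c < k)%N)%:R *: psi a c (r + m) w =
      \sum_(c' < k) \sum_(j < n) ((b == d) && ((c' == c :> nat) &&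
        (A + j%:Z == r)))%:R *: psi a c' (A + j%:Z + m) w.
    case: eqP => _; last first.
      by rewrite scale0r big1 // => c' _; rewrite big1 // => j _; rewrite scale0r.
    rewrite /= (delta_sum (fun c' s => psi a c' (s + m) w)) //; lia.
  rewrite linear_sum -big_split; apply: eq_bigr => c' _ /=.
  rewrite linear_sum -big_split; apply: eq_bigr => j _ /=.
  rewrite psis_psi linearB linearZ /= [in LHS]psi_psi opprK [LHS]addrC.
  congr (_ + _ *: _).
  by rewrite !xpair_eqE andbA.
rewrite h; [|lia|lia].
by rewrite linearD linearZ [LHS]addrAC.
Qed.

Lemma bil_psis d c r w : bil (psis d c r w) =
  psis d c r (bil w) - ((a == d) && (c < k)%N)%:R *: psis b c (r - m) w.
Proof.
have [N h] := tr_bil w.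
apply: (@bil_uniq _ _ (N + `|r|.+1 + `|m|)) => A n An1 An2.
have -> : tr A n (psis d c r w) =
   psis d c r (tr A n w) - ((a == d) && (c < k)%N)%:R *: psis b c (r - m) w.
  have -> : ((a == d) && (c < k)%N)%:R *: psis b c (r - m) w =
      \sum_(c' < k) \sum_(j < n) ((a == d) && ((c' == c :> nat) &&
        (A + j%:Z == r - m)))%:R *: psis b c' (A + j%:Z) w.
    case: eqP => _; last first.
      by rewrite scale0r big1 // => c' _; rewrite big1 // => j _; rewrite scale0r.
    rewrite /= (delta_sum (fun c' s => psis b c' s w)) //; lia.
  rewrite linear_sum -sumrB; apply: eq_bigr => c' _ /=.
  rewrite linear_sum -sumrB; apply: eq_bigr => j _ /=.
  rewrite psis_psis linearN /= [in LHS]psi_psis opprB; congr (_ - _ *: _).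
  by rewrite !xpair_eqE -andbA; congr (_ && (_ && _))%:R; lia.
rewrite h; [|lia|lia].
by rewrite linearD linearZ [LHS]addrAC.
Qed.

End Bilinear.

(** The bilinears close under the bracket, being derivations of the fermions by
    bil_psi and bil_psis. The central term comes from the truncation: in the two
    sums that arise from the bracket the numbers of subtracted pairs differ by m for
    each of the k colours. *)
Lemma bil_bil a b m a' b' n w :
  bil a b m (bil a' b' n w) = bil a' b' n (bil a b m w)
  + (b == a')%:R *: bil a b' (m + n) w - (a == b')%:R *: bil a' b (m + n) w
  + (m%:~R * [&& a == b', b == a' & m + n == 0]%:R * k%:R) *: w.
Proof.
have [N1 h1] := tr_bil a' b' n w.
have [N2 h2] := tr_bil a' b' n (bil a b m w).
have [N3 h3] := tr_bil a b' (m + n) w.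
have [N4 h4] := tr_bil a' b (m + n) w.
pose N := (N1 + N2 + N3 + N4 + `|m|)%N; pose A : int := - N%:Z.
pose L := (N + N)%N.
have E : bil a b m (tr a' b' n A L w) = tr a' b' n A L (bil a b m w)
    + (b == a')%:R *: tr a b' (m + n) A L w
    - (a == b')%:R *: tr a' b (m + n) (A - m) L w.
  rewrite linear_sum !scaler_sumr -big_split -sumrB /=; apply: eq_bigr => c _.
  rewrite linear_sum !scaler_sumr -big_split -sumrB /=; apply: eq_bigr => j _.
  rewrite bil_psi bil_psis !ltn_ord !andbT linearB linearZ /=.
  rewrite addrAC.
  congr (_ + _ *: fpsi (_, _, _) _ - _ *: fpsi (_, _, _) (fpsis (_, _, _) _)); lia.
move: E; rewrite h1 ?h2 ?h3 ?h4; try by rewrite /A /L /N; lia.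
rewrite linearD linearZ /=.
have -> : m%:~R * [&& a == b', b == a' & m + n == 0]%:R * k%:R =
   (b == a')%:R * (k%:R * (A + L%:Z)%:~R * kap a b' (m + n)) -
   (a == b')%:R * (k%:R * (A - m + L%:Z)%:~R * kap a' b (m + n)).
  rewrite /kap [a' == b]eq_sym; case: (b == a'); case: (a == b');
  by case: (m + n == 0); rewrite /= ?intrD ?intrB; ring.
move: (bil a b m (bil a' b' n w)) (bil a' b' n (bil a b m w)) => Z Z'.
move: (bil a b m w) (bil a b' _ w) (bil a' b _ w) => B P Q.
move: (_ * _ * kap a' b' n) (_ * _ * kap a b' _) (_ * _ * kap a' b _) => s s1 s2.
move=> E; apply: (addIr (s *: B)); rewrite E scalerBl !scalerDr !scalerA opprD.
by rewrite !addrA [LHS](ACl (1*3*5*4*6*2)).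
Qed.

(** ** The affine algebra in the Fock space *)

Definition fock_op (e : sl2_basis) (m : int) : {linear V -> V} :=
  match e with
  | Xpos => bil true false m
  | Xneg => bil false true m
  | Hcar => bil true true m \- bil false false m
  end.

Lemma fock_opC e f m n w : fock_op e m (fock_op f n w) =
    fock_op f n (fock_op e m w) + (br e f)%:~R *: fock_op (tg e f) (m + n) w
    + ((m * kf e f)%:~R * (m + n == 0)%:R * k%:R) *: w.
Proof.
have two (z : V) : 2%:~R *: z = z + z by rewrite -mulr2n -scaler_nat.
have mtwo (z : V) : (-2)%:~R *: z = - z - z.
  by rewrite -[-2]/(- (2 : int)) rmorphN scaleNr two opprD.
have mone (z : V) : (-1)%:~R *: z = - z by rewrite -scaleN1r.
pose simp := (scale0r, scale1r, mul0r, mulr0, mul1r, mulr1, subr0, addr0, add0r).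
have bilB a b l x y : bil a b l (x - y) = bil a b l x - bil a b l y.
  exact: linearB.
case: e f => [] [] /=; rewrite ?simp.
- by rewrite bil_bil /= !simp.
- rewrite bilB (bil_bil false true m true) (bil_bil false true m false) /= !simp.
  by rewrite two; exact: add_subsub.
- by rewrite bil_bil /= !simp mone opprB addrA.
- rewrite bilB (bil_bil true true m) (bil_bil false false m) /= !simp mtwo.
  exact: sub_subadd.
- rewrite !bilB (bil_bil true true m true true) (bil_bil true true m false false).
  rewrite (bil_bil false false m true true) (bil_bil false false m false false).
  rewrite /= !simp !addrK; set d := _ * k%:R; set d2 := _ * k%:R.
  have -> : d2 *: w = d *: w + d *: w.
    by rewrite -scalerDl /d /d2 intrM; congr (_ *: _); ring.
  exact: sub_sub_central.
- rewrite bilB (bil_bil true true m) (bil_bil false false m) /= !simp two.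
  exact: add_subsub.
- by rewrite bil_bil /= !simp addrA.
- rewrite bilB (bil_bil true false m true) (bil_bil true false m false) /= !simp.
  by rewrite mtwo; exact: sub_subadd.
- by rewrite bil_bil /= !simp.
Qed.

Definition fock : currents k V := Currents fock_opC.

(** The current x_alpha turns the second basis vector of C^2 into the first one,
    which it kills. So the fermions of the first kind commute with it. *)
Lemma fock_X_psi c r m w : cop fock Xpos m (psi true c r w) =
  psi true c r (cop fock Xpos m w).
Proof. by rewrite /= bil_psi scale0r addr0. Qed.

Section Form.
Variable hform : V -> V -> K.
Hypothesis hform_linl : forall a x y z,
  hform (a *: x + y) z = a^* * hform x z + hform y z.
Hypothesis hform_linr : forall a x y z,
  hform x (a *: y + z) = a * hform x y + hform x z.
Hypothesis hform_psi : forall p x y, hform (fpsi p x) y = hform x (fpsis p y).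
Hypothesis hform_psis : forall p x y, hform (fpsis p x) y = hform x (fpsi p y).
Hypothesis hform_ge0 : forall x, 0 <= hform x x.
Hypothesis hform_eq0 : forall x, hform x x = 0 -> x = 0.

Let hformDl x y z : hform (x + y) z = hform x z + hform y z.
Proof. by rewrite -{1}[x]scale1r hform_linl conjC1 mul1r. Qed.

Let hformDr x y z : hform x (y + z) = hform x y + hform x z.
Proof. by rewrite -{1}[y]scale1r hform_linr mul1r. Qed.

Let hform0l y : hform 0 y = 0.
Proof. by apply: (addrI (hform 0 y)); rewrite -hformDl !addr0. Qed.

Let hform0r y : hform y 0 = 0.
Proof. by apply: (addrI (hform y 0)); rewrite -hformDr !addr0. Qed.

Let hformZl a x y : hform (a *: x) y = a^* * hform x y.
Proof. by rewrite -{1}[a *: x]addr0 hform_linl hform0l addr0. Qed.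

Let hformZr a x y : hform x (a *: y) = a * hform x y.
Proof. by rewrite -{1}[a *: y]addr0 hform_linr hform0r addr0. Qed.

Let hformBl x y z : hform (x - y) z = hform x z - hform y z.
Proof. by rewrite -scaleN1r hformDl hformZl rmorphN1 mulN1r. Qed.

Let hformBr x y z : hform x (y - z) = hform x y - hform x z.
Proof. by rewrite -scaleN1r hformDr hformZr mulN1r. Qed.

(** The adjoint of a bilinear is obtained by reversing it; the subtracted
    numbers of pairs occur only for m = 0, and then they agree. *)
Lemma bil_star a b m x y : hform (bil a b m x) y = hform x (bil b a (- m) y).
Proof.
have [N1 h1] := tr_bil a b m x.
have [N2 h2] := tr_bil b a (- m) y.
pose N := (N1 + N2 + `|m|)%N; pose A : int := - N%:Z.
pose L := (N + N)%N.
have E : hform (tr a b m A L x) y = hform x (tr b a (- m) (A + m) L y).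
  have suml I r (P : pred I) (G : I -> V) z :
      hform (\sum_(i <- r | P i) G i) z = \sum_(i <- r | P i) hform (G i) z.
    exact: (big_morph (hform^~ z) (fun u v => hformDl u v z) (hform0l z)).
  have sumr I r (P : pred I) (G : I -> V) z :
      hform z (\sum_(i <- r | P i) G i) = \sum_(i <- r | P i) hform z (G i).
    exact: (big_morph (hform z) (hformDr z) (hform0r z)).
  rewrite suml sumr; apply: eq_bigr => c _; rewrite suml sumr.
  apply: eq_bigr => j _; rewrite hform_psi hform_psis.
  by congr (hform _ (fpsi (_, _, _) (fpsis (_, _, _) _))); lia.
move: E; rewrite h1 ?h2; try by rewrite /A /L /N; lia.
rewrite hformDl hformDr hformZl hformZr.
set s1 := _ * _ * kap a b m; set s2 := _ * _ * kap b a _.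
suff -> : s1^* = s2 by move/addIr.
rewrite /s1 /s2 /kap !rmorphM /= !conjC_nat.
rewrite (rmorph_int (Num.conj : {rmorphism K -> K})).
rewrite oppr_eq0 [b == a]eq_sym.
by have [->|] := eqVneq m 0; rewrite ?addr0 // andbF !mulr0.
Qed.

Lemma fock_star e m x y :
  hform (cop fock e m x) y = hform x (cop fock (star e) (- m) y).
Proof.
by case: e; rewrite /= ?bil_star // hformBl hformBr !bil_star.
Qed.

Definition fock_unitary : unitary fock :=
  Unitary hform_linl hform_linr fock_star hform_ge0 hform_eq0.

End Form.

Section Vacua.
Variable vac : V.
Hypothesis vac_neq0 : vac != 0.
Hypothesis psi_vac : forall p, 0 <= p.2 -> fpsi p vac = 0.
Hypothesis psis_vac : forall p, p.2 < 0 -> fpsis p vac = 0.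

Lemma bil_vac a b m : 0 <= m -> bil a b m vac = 0.
Proof.
move=> m0; apply: (@bil_uniq _ _ _ _ _ 0) => A n An1 An2; rewrite add0r.
rewrite /tr -mulrA -scalerA scaler_nat -[X in _ *+ X]card_ord -sumr_const.
apply: eq_bigr => c _.
have [x ex] : exists x : nat, A = - x%:Z by exists `|A|%N; lia.
have [M eM] : exists M : nat, n = (x + M)%N by exists (n - x)%N; lia.
rewrite {n}eM {A}ex in An1 An2 *; rewrite big_split_ord /= big1 => [|j _].
  rewrite add0r (_ : - x%:Z + (x + M)%N%:Z = M%:Z); last by lia.
  rewrite -[M%:~R]/(M%:R) -scalerA scaler_nat -[X in _ *+ X]card_ord -sumr_const.
  apply: eq_bigr => j _; rewrite psi_psis psi_vac /=; last by lia.
  rewrite linear0 subr0; congr (_%:R *: _).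
  by rewrite !xpair_eqE eqxx andbT; congr (nat_of_bool (_ && _)); lia.
by rewrite psis_vac ?linear0 //=; have := ltn_ord j; lia.
Qed.

(** Adding the mode of t^-1 in the colours 0, ..., i - 1 raises the weight of the vacuum
    to i: each of the k colours has level one and contributes Lambda_0 or Lambda_1 to
    the highest weight. *)
Fixpoint fockv (i : nat) : V :=
  if i is i'.+1 then psi true i' (-1) (fockv i') else vac.

Lemma psi_fockv p i : 0 <= p.2 -> fpsi p (fockv i) = 0.
Proof.
move=> p0; elim: i => [|i IH]; first exact: psi_vac.
by rewrite /= psi_psi IH linear0 oppr0.
Qed.

Lemma psis_fockv c i : (i <= c)%N -> psis true c (-1) (fockv i) = 0.
Proof.
elim: i => [|i IH] ic; first exact: psis_vac.
rewrite /= psis_psi IH ?(ltnW ic) // linear0 subr0 !xpair_eqE /=.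
by rewrite gtn_eqF ?scale0r.
Qed.

Lemma fockv_neq0 i : fockv i != 0.
Proof.
elim: i => [|i IH] //=; apply/eqP => e; case/eqP: IH.
have := psis_psi (true, i, -1) (true, i, -1) (fockv i).
by rewrite e psis_fockv // [fpsis _ 0]linear0 [fpsi _ 0]linear0 eqxx scale1r subr0.
Qed.

Lemma bil_fockv a b m i : 0 < m -> bil a b m (fockv i) = 0.
Proof.
move=> m0; elim: i => [|i IH]; first by apply: bil_vac; apply: ltW.
by rewrite /= bil_psi IH linear0 add0r psi_fockv ?scaler0 //=; lia.
Qed.

Lemma bil0_fockv a b i : (i <= k)%N -> b = false \/ a = true /\ b = true ->
  bil a b 0 (fockv i) = (i%:R * b%:R) *: fockv i.
Proof.
move=> ik ab; elim: i ik => [|i IH] ik.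
  by rewrite mul0r scale0r; apply: bil_vac.
rewrite /= bil_psi IH ?(ltnW ik) // linearZ /= addr0 ik andbT.
case: ab => [->|[-> ->]]; first by rewrite /= !mulr0 !scale0r addr0.
by rewrite eqxx -scalerDl !mulr1 natr1.
Qed.

Lemma fockv_hw i : (i <= k)%N -> hw_vector fock i (fockv i).
Proof.
move=> ik; split; first exact: fockv_neq0.
- by rewrite /= bil0_fockv //; [rewrite mulr0 scale0r|left].
- by move=> [] m m0 /=; rewrite !bil_fockv ?subr0.
rewrite /= !bil0_fockv //; [|by left|by right].
by rewrite mulr1 mulr0 scale0r subr0.
Qed.

End Vacua.
End Fock.

(** ** The unitary model *)

Section FockModel.
Variables (K : numClosedFieldType) (k : nat).
Local Notation fmode := (bool * nat * int)%type.
Local Notation F := {malg K[{fset fmode}]}.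

Let filled : pred fmode := fun p => 0 <= p.2.

Let fbound (w : F) : nat :=
  \max_(S <- msupp w) \max_(p <- S) `|p.2|%N.+1.

Let an_far (w : F) p : (fbound w <= `|p.2|)%N -> an p w = 0.
Proof.
move=> wp; apply: an_supp => S Sw; apply/negP => pS.
suff: (`|p.2|%N.+1 <= fbound w)%N by rewrite ltnNge wp.
rewrite /fbound (big_fsetD1 S) //=; apply: leq_trans (leq_maxl _ _).
by rewrite (big_fsetD1 p) //= leq_maxl.
Qed.

Let psi_far p w : (fbound w)%:Z <= p.2 -> psi K filled p w = 0.
Proof.
move=> wp; have p0 : 0 <= p.2 by apply: le_trans wp.
by rewrite /psi /filled p0; apply: an_far; rewrite -lez_nat gez0_abs.
Qed.

Let psis_far p w : p.2 < 0 -> (fbound w)%:Z <= - p.2 -> psis K filled p w = 0.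
Proof.
move=> p0 wp; rewrite /psis /filled leNgt p0; apply: an_far.
by rewrite -lez_nat ltz0_abs.
Qed.

Let psi_vac p : 0 <= p.2 -> psi K filled p (vac K fmode) = 0.
Proof. by move=> p0; rewrite /psi /filled p0; apply: an_vac. Qed.

Let psis_vac p : p.2 < 0 -> psis K filled p (vac K fmode) = 0.
Proof.
by move=> p0; rewrite /psis /filled leNgt p0; apply: an_vac.
Qed.

(** The module is generated by k colours of fermions, and T i is the fermion
    psi(true, i, -1). Only this interface is used in the study of the kernel. *)
Lemma fock_model : exists (V : lmodType K) (C : currents k V)
    (U : unitary C) (v : nat -> V) (T : nat -> {linear V -> V}),
  [/\ forall i, (i <= k)%N -> hw_vector C i (v i),
      forall i m w, T i (cop C Xpos m w) = cop C Xpos m (T i w)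
    & forall i, T i (v i) = v i.+1].
Proof.
pose C := fock k (@psi_psi K _ filled) (@psis_psis K _ filled)
  (@psi_psis K _ filled) psi_far psis_far.
exists F, C.
have U : unitary C.
  apply: fock_unitary.
  - exact: fform_linl.
  - exact: fform_linr.
  - exact: fform_psi.
  - exact: fform_psis.
  - exact: fform_ge0.
  - exact: fform_eq0.
exists U, (fockv (psi K filled) (vac K fmode)), (fun i => psi K filled (true, i, -1)).
split=> [i ik|i m w|i //].
- by apply: fockv_hw => //; apply: vac_neq0.
- by symmetry; apply: fock_X_psi.
Qed.

End FockModel.

(** * The kernel in the Fock space *)

Section IdealTheory.
Variable K : numClosedFieldType.
Local Notation x m := (xa K m).
Local Notation Uneg := (@Unbar_le K (-1)).
Local Notation J := (relideal (xa K) Uneg).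

Lemma Uneg_xneg p : (0 < p)%N -> Uneg (x (- p%:Z)).
Proof. by move=> p0; apply: Ule_xa; lia. Qed.

Lemma homog_rel d n t : homog xwt (- t%:Z, n%:Z) (rel (xa K) d n t).
Proof.
elim: n t => [|n IH] t.
  rewrite rel0; case: eqP => [->|_]; first exact: homog1.
  exact: all_supp0.
rewrite relS; apply: all_supp_sum => p _; rewrite /cur.
case: ifP => _; last by rewrite mul0r; apply: all_supp0.
have -> : (- t%:Z, n.+1%:Z) = xwt (- p%:Z) + (- (t - p)%N%:Z, n%:Z).
  by rewrite -[RHS]/(- p%:Z + - (t - p)%N%:Z, 1 + n%:Z); congr (_, _);
    have := ltn_ord p; lia.
apply: homogM; [exact: homog_xa|exact: IH].
Qed.

Lemma proj_sum (d : int * int) I (r : seq I) (P : pred I) (G : I -> Unbar K) :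
  proj xwt d (\sum_(i <- r | P i) G i) = \sum_(i <- r | P i) proj xwt d (G i).
Proof. by apply: big_morph => [a b|]; [exact: projD|exact: proj0]. Qed.

Lemma relspan_proj k d s :
  relspan Uneg k.+1 (rel (xa K) 1 k.+1) s ->
  relspan Uneg k.+1 (rel (xa K) 1 k.+1) (proj xwt d s).
Proof.
case=> N [g [hg ->]].
exists N, (fun t => proj xwt (d - (- t%:Z, k.+1%:Z)) (g t)); split=> [t|].
  exact/Ule_proj.
rewrite proj_sum; apply: eq_bigr => t _; apply: projM; exact: homog_rel.
Qed.

Lemma relideal_proj k i d a : J k i a -> J k i (proj xwt d a).
Proof.
case=> s [b [hs hb ->]].
exists (proj xwt d s), (proj xwt (d - xwt (-1) *+ (k - i + 1)) b); split.
- exact: relspan_proj.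
- exact: Ule_proj.
rewrite projD; congr (_ + _); apply: projM; exact/homogX/homog_xa.
Qed.

Definition drop1 (m : int) : Unbar K := if m == -1 then 0 else x m.

Lemma Ule_drop1 a : Uneg a -> Unbar_le (-2) (subst drop1 a).
Proof.
apply: Ule_subst => m m1; rewrite /drop1; case: eqP => m2; first exact: Ule0.
by apply: Ule_xa; lia.
Qed.

Lemma drop1_mod a : Uneg a ->
  exists2 b, Uneg b & a = subst drop1 a + x (-1) * b.
Proof.
apply: subst_mod => [m m1|m m1|]; rewrite /drop1; last exact: Ule_xa.
  by case: eqP => _; [exact: Ule0|exact: Ule_xa].
case: eqP => [->|_]; first by exists 1; [exact: Ule1|rewrite add0r mulr1].
by exists 0; [exact: Ule0|rewrite mulr0 addr0].
Qed.

Definition shift (s m : int) : Unbar K := x (m + s).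

Lemma subst_comp (f g : int -> Unbar K) a :
  subst g (subst f a) = subst (fun m => subst g (f m)) a.
Proof.
move: a; apply: malg_ind => [|a b ha hb|c u].
- by rewrite !rmorph0.
- have -> : subst f (a + b) = subst f a + subst f b by exact: rmorphD.
  apply: etrans (rmorphD _ _ _) _; apply: etrans (esym (rmorphD _ _ _)).
  by apply: congr2; [exact: ha|exact: hb].
apply: etrans (congr1 (subst g) (substZ f c _)) _.
apply: etrans (substZ g c _) _; apply: etrans (esym (substZ _ c _)).
apply: (congr1 ( *:%R c)); apply: etrans (congr1 (subst g) (substU f u)) _.
apply: etrans (esym (substU _ u)).
apply: etrans (rmorph_prod _ _ _ _) _; apply: eq_bigr => m _; exact: rmorphXn.
Qed.

Lemma subst_monom_xa u : subst_monom (xa K) u = << u >>.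
Proof.
elim/cmonom_ind: u => [|m u IH]; first exact: (subst_monom_mult (xa K)).2.
apply: etrans ((subst_monom_mult (xa K)).1 _ _) _.
apply: etrans (congr2 *%R _ IH) _; last exact: malgMUU.
by apply: etrans (esym (substU _ _)) _; exact: subst_xa.
Qed.

Lemma subst_id (theta : int -> Unbar K) a :
  all_supp (fun u => forall m, m \in finsupp u -> theta m = x m) a ->
  subst theta a = a.
Proof.
move: a; apply: all_supp_ind => [|a b ha hb|c u hu].
- exact: rmorph0.
- apply: etrans (rmorphD _ _ _) _.
  by apply: congr2; [exact: ha|exact: hb].
apply: etrans (substZ _ c _) _; apply: (congr1 ( *:%R c)).
apply: etrans (substU _ u) _; apply: etrans (subst_monom_xa u).
by apply: eq_big_seq => m mu; rewrite hu.
Qed.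

Lemma drop1_id a : Unbar_le (-2) a -> subst drop1 a = a.
Proof.
move=> ha; apply: subst_id => u ua m mu; rewrite /drop1.
by case: eqP => // m1; have := ha u ua m mu; rewrite m1.
Qed.

Lemma shiftK s a : subst (shift (- s)) (subst (shift s) a) = a.
Proof.
rewrite subst_comp; apply: subst_id => u _ m _.
rewrite subst_xa /shift; congr (x _); lia.
Qed.

Let L1 := @Ule1 K (-1).
Let LD := @UleD K (-1).
Let LM := @UleM K (-1).
Let LZ := @UleZ K (-1).

Let JD k i a b : J k i a -> J k i b -> J k i (a + b).
Proof. exact: (relidealD L1 LD LZ). Qed.

Let JM k i c a : Uneg c -> J k i a -> J k i (c * a).
Proof. exact: (relidealM LM). Qed.

(** The shift turns the generators of the ideal of weight k - i into the
    coefficients of the powers of x(-2) z^2 + x(-3) z^3 + ... and into x(-2)^(i+1).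
    Times x(-1)^(k-i) they are in the ideal of weight i by relideal_rel2 and
    relideal_pow2. *)
Lemma relideal_shift k i a : (i <= k)%N ->
  J k (k - i) a -> J k i (subst (shift (-1)) a * x (-1) ^+ (k - i)).
Proof.
move=> ik [s [b [[N [g [hg ->]]] hb ->]]].
have hs c : Uneg c -> Uneg (subst (shift (-1)) c).
  by apply: Ule_subst => m m1; apply: Ule_xa; lia.
rewrite rmorphD rmorph_sum mulrDl mulr_suml.
apply: JD.
  apply: big_ind => [|? ? ha hb'|t _]; [exact: (relideal0 _ L1 LZ)|exact: JD|].
  rewrite rmorphM /=.
  rewrite (rmorph_rel_shift (y := xa K)) => [|p]; last first.
    rewrite /cur; case: p => [|p] /=; first exact: rmorph0.
    by rewrite subst_xa /shift; congr (x _); lia.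
  rewrite -mulrA [rel _ _ _ _ * _]mulrC; apply: JM; first exact: hs.
  exact: (relideal_rel2 L1 LD LM LZ k i Uneg_xneg).
rewrite rmorphM rmorphXn /= subst_xa /shift.
rewrite (_ : (k - (k - i) + 1 = i.+1)%N); last by lia.
rewrite -mulrA [x _ ^+ _ * _]mulrC; apply: JM; first exact: hs.
exact: (relideal_pow2 L1 LD LM LZ Uneg_xneg ik).
Qed.

End IdealTheory.

Fact split_power (A : comNzRingType) (s c b y : A) n :
  s + (c + y * b) * y ^+ n = s + b * y ^+ (n + 1) + c * y ^+ n.
Proof. by rewrite addn1 exprS; ring. Qed.

Fact absz_add_lt (p q : int) : p <= 0 -> 0 <= q -> q != 0 -> p + q <= 0 ->
  (`|(p + q)%R| < `|p|)%N.
Proof. lia. Qed.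

Section Kernel.
Variables (K : numClosedFieldType) (k : nat).
Local Notation x m := (xa K m).
Local Notation Uneg := (@Unbar_le K (-1)).
Local Notation J := (relideal (xa K) Uneg).

Let L1 := @Ule1 K (-1).
Let LD := @UleD K (-1).
Let LM := @UleM K (-1).
Let LZ := @UleZ K (-1).

Lemma deg_charge (u : {cmonom int}) : (deg xwt u).2 = (mdeg u)%:Z.
Proof.
rewrite /deg /mdeg; elim: (enum_fset _) => [|m s IH]; rewrite ?big_nil //.
rewrite !big_cons -[LHS]/((xwt m *+ u m).2 + (\sum_(j <- s) xwt j *+ u j).2) IH.
rewrite PoszD; congr (_ + _).
elim: (u m) => [|n IHn] //; rewrite mulrS.
by rewrite -[LHS]/(1 + (xwt m *+ n).2) IHn; lia.
Qed.

Lemma deg_energy (u : {cmonom int}) :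
  (forall m, m \in finsupp u -> m <= -1) -> (deg xwt u).1 <= 0.
Proof.
rewrite /deg; rewrite -[(finsupp u : {fset int})]/(finsupp u) => hu.
rewrite big_seq; apply: (big_ind (fun d : int * int => d.1 <= 0)) => //.
  by move=> d e d0 e0; rewrite -[X in X <= 0]/(d.1 + e.1); lia.
move=> m /hu m1; have m0 : m <= 0 by apply: le_trans m1 _.
elim: (u m) => [|n IHn] //; rewrite mulrS.
by have := lerD m0 IHn; rewrite addr0.
Qed.

(** The ideal of weight i + 1 is generated, modulo the relations, by x(-1)^(k-i);
    a factor x(-1) in the coefficient of this power leads back to the ideal of
    weight i. For i = k the power is 1, and the element a is arbitrary. *)
Lemma relideal_reduce i a : (i <= k)%N -> Uneg a -> J k i.+1 a \/ i = k ->
  exists c b, [/\ J k i c, Unbar_le (-2) b & a = c + b * x (-1) ^+ (k - i)].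
Proof.
move=> ik ha hai.
have [s [b [hs hb e]]] : exists s b, [/\ relspan Uneg k.+1 (rel (xa K) 1 k.+1) s,
    Uneg b & a = s + b * x (-1) ^+ (k - i)].
  have [ek|ik'] : i = k \/ (i < k)%N by lia.
    exists 0, a; split; [exact: (relspan0 L1 LZ)|exact: ha|].
    by rewrite ek subnn expr0 mulr1 add0r.
  case: hai => [[s [b [hs hb e]]]|ei]; last by rewrite ei ltnn in ik'.
  exists s, b; split; [exact: hs|exact: hb|].
  by have <- : (k - i.+1 + 1 = k - i)%N by lia.
have [b' hb' eb] := drop1_mod hb.
exists (s + b' * x (-1) ^+ (k - i + 1)), (subst (drop1 K) b); split.
- by exists s, b'; split; [exact: hs|exact: hb'|exact: erefl].
- exact: Ule_drop1.
apply: etrans e _.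
transitivity (s + (subst (drop1 K) b + x (-1) * b') * x (-1) ^+ (k - i)).
  by congr (_ + _ * _); exact: eb.
exact: split_power.
Qed.

(** The effect of the shift of all modes by one on the bidegrees. *)
Definition shear (d : int * int) : int * int := (d.1 + d.2, d.2).

Lemma shear_charge d n : (shear (d - xwt (-1) *+ n)).1 = d.1 + d.2.
Proof.
elim: n => [|n IH]; first by rewrite mulr0n subr0.
move: IH; rewrite mulrS; case: (xwt (-1) *+ n) => p q.
rewrite /shear /= => <-.
by rewrite -[LHS]/(d.1 - (-1 + p) + (d.2 - (1 + q))) -[RHS]/(d.1 - p + (d.2 - q)); lia.
Qed.

Lemma homog_shift d (b : Unbar K) :
  homog xwt d b -> homog xwt (shear d) (subst (shift K 1) b).
Proof.
apply: homog_subst => [|d1 d2|m]; first by rewrite /shear.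
  by rewrite -[LHS]/(d1.1 + d2.1 + (d1.2 + d2.2), d1.2 + d2.2) /shear addrACA.
exact: homog_xa.
Qed.

Section Fock.
Variables (V : lmodType K) (C : currents k V) (U : unitary C).
Variables (v : nat -> V) (T : nat -> {linear V -> V}).
Hypothesis hv : forall i, (i <= k)%N -> hw_vector C i (v i).
Hypothesis TX : forall i m w, T i (cop C Xpos m w) = cop C Xpos m (T i w).
Hypothesis Tv : forall i, T i (v i) = v i.+1.
Local Notation X := (cop C Xpos).

Lemma intertwine i a w : T i (uact X a w) = uact X a (T i w).
Proof.
rewrite /uact /lext linear_sum; apply: eq_bigr => u _; rewrite linearZ /=.
congr (_ *: _); rewrite /mact; elim: (enum_fset _) => //= m s <-.
by elim: (u m) => //= n <-; rewrite TX.
Qed.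

Let dC : dominant C := unitary_dominant U.

Lemma homog_degree d (a : Unbar K) : a != 0 -> Uneg a -> homog xwt d a ->
  d.1 <= 0 /\ 0 <= d.2.
Proof.
rewrite -msupp_eq0 => /fset0Pn[u ua] ha da; rewrite -(da u ua) deg_charge.
by split=> //; apply: deg_energy; apply: ha.
Qed.

Lemma homog_charge0 d (a : Unbar K) : homog xwt d a -> d.2 = 0 -> a = a@_mone *: 1.
Proof.
move=> da d0; apply/malgP => u; rewrite mcoeffZ mcoeff1.
have [->|u1] := eqVneq u mone; first by rewrite mulr1.
rewrite mulr0; have [ua|/mcoeff_outdom //] := boolP (u \in msupp a).
case/eqP: u1; apply/eqP; rewrite -mdeg_eq0 -eqz_nat -deg_charge.
by rewrite (da u ua) d0.
Qed.

Let JD i a b : J k i a -> J k i b -> J k i (a + b).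
Proof. exact: (relidealD L1 LD LZ). Qed.

(** One step of the descent. By relideal_reduce, a is b0 x(-1)^(k-i) modulo the
    ideal of weight i, with b0 free of x(-1). As b0 kills x(-1)^(k-i) (v i), which is a
    highest weight vector of weight k - i for the twisted currents, the shifted
    element b1 kills v (k - i), by unitary_kernel. Its energy is that of a plus the
    charge of a, hence closer to zero, and the induction hypothesis applies to b1.
    Then relideal_shift returns to a. *)
Lemma fock_step i d (a : Unbar K) :
  (forall i' d' a', (i' <= k)%N -> (`|d'.1| < `|d.1|)%N -> Uneg a' ->
    homog xwt d' a' -> uact X a' (v i') = 0 -> J k i' a') ->
  (i <= k)%N -> Uneg a -> homog xwt d a -> uact X a (v i) = 0 ->
  J k i.+1 a \/ i = k -> J k i a.
Proof.
move=> IH ik ha da av hai.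
have [->|a0] := eqVneq a 0; first exact: (relideal0 _ L1 LZ).
have [d1 d2] := homog_degree a0 ha da.
have [d20|d20] := eqVneq d.2 0.
  case/eqP: a0; have e := homog_charge0 da d20; move: av; rewrite e uactZl uact1.
  move/eqP; rewrite scaler_eq0 (negbTE (hw_neq0 (hv ik))) orbF => /eqP ->.
  exact: scale0r.
have [c [b [hc hb e]]] := relideal_reduce ik ha hai.
pose d' := d - xwt (-1) *+ (k - i); pose b0 := proj xwt d' b.
have {}e : a = proj xwt d c + b0 * x (-1) ^+ (k - i).
  rewrite -{1}(proj_id da) {1}e projD; congr (_ + _); apply: projM.
  exact/homogX/homog_xa.
have {}hc : J k i (proj xwt d c) by apply: relideal_proj.
have {}hb : Unbar_le (-2) b0 by apply: Ule_proj.
have db : homog xwt d' b0 by apply: proj_homog.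
pose w := iter (k - i) (X (-1)) (v i).
have bw : uact X b0 w = 0.
  move: av; rewrite e [LHS]uactDl (relideal_ker ik dC (hv ik) hc) add0r.
  rewrite uactM; last exact: copXX.
  rewrite uactXn; last exact: copXX.
  rewrite (eq_iter (f' := X (-1))) // => z; exact: uact_xa.
pose b1 := subst (shift K 1) b0.
have hb1 : Uneg b1 by apply: Ule_subst hb => m m2; apply: Ule_xa; lia.
have db1 : homog xwt (shear d') b1 := homog_shift db.
have b1w : uact (cop (twist C) Xpos) b1 w = 0.
  rewrite -[RHS]bw; apply: uact_subst => [|m z]; first exact: copXX.
  by rewrite uact_xa twistX addrK.
have b1v : uact X b1 (v (k - i)) = 0.
  rewrite -(proj_id db1).
  apply: (unitary_kernel (twist_hw ik dC (hv ik)) (hv (leq_subr i k)) U _ b1w).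
  by move=> u /db1 ->.
have hb0 : J k (k - i) b1.
  have [->|b10] := eqVneq b1 0; first exact: (relideal0 _ L1 LZ).
  apply: (IH _ _ _ (leq_subr _ _) _ hb1 db1 b1v).
  have [+ _] := homog_degree b10 hb1 db1.
  rewrite shear_charge; exact: absz_add_lt.
rewrite e; apply: JD; first exact: hc.
have := relideal_shift ik hb0.
by rewrite [subst _ b1](shiftK 1).
Qed.

(** Induction on the energy, and for a given energy descending induction on the
    weight i: if a kills v i then it kills v (i + 1), by the intertwining operator, so
    that a is known to be in the ideal of weight i + 1. *)
Lemma fock_kernel i d (a : Unbar K) : (i <= k)%N -> Uneg a -> homog xwt d a ->
  uact X a (v i) = 0 -> J k i a.
Proof.
move: {2}(`|d.1|%N).+1 (ltnSn `|d.1|%N) => N; elim: N i d a => // N IHN i d a.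
move=> dN ik; move: {2}(k - i)%N (erefl (k - i)%N) => j.
elim: j i ik => [|j IHj] i ik ej ha da av.
  apply: (fock_step (d := d)) => // [i' d' a' ik' dd'|]; last by right; lia.
  by apply: IHN => //; apply: leq_trans dd' _.
apply: (fock_step (d := d)) => // [i' d' a' ik' dd'|].
  by apply: IHN => //; apply: leq_trans dd' _.
left; apply: IHj => //; [by lia|by lia|].
by rewrite -Tv -intertwine av linear0.
Qed.

End Fock.
End Kernel.

(** * Standard modules *)

Section BasisBrackets.
Variable K : fieldType.

Lemma sl2_mulmx e f (i j : 'I_2) : (sl2_mx K e *m sl2_mx K f) i j =
  sl2_mx K e i 0 * sl2_mx K f 0 j + sl2_mx K e i 1 * sl2_mx K f 1 j.
Proof.
by rewrite mxE !big_ord_recl big_ord0 addr0 (_ : lift ord0 ord0 = 1) //; apply: val_inj.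
Qed.

Lemma sl2_commutator e f (i j : 'I_2) :
  sl2_mx K e i 0 * sl2_mx K f 0 j + sl2_mx K e i 1 * sl2_mx K f 1 j -
  (sl2_mx K f i 0 * sl2_mx K e 0 j + sl2_mx K f i 1 * sl2_mx K e 1 j) =
  (br e f)%:~R * sl2_mx K (tg e f) i j.
Proof.
case: i => [[|[|//]] ?]; case: j => [[|[|//]] ?]; case: e; case: f;
  rewrite /= !mxE /= ?(mulr0, mul0r, mulr1, mul1r, addr0, add0r, subr0, sub0r) //;
  rewrite ?oppr0 //; ring.
Qed.

(** Stated for arbitrary vectors, because comparing distinct basis elements by
    conversion is expensive. *)
Fact scale_unit_basis (W : lmodType K) (c : K) (x y z : W) :
  [/\ (c * 1) *: x + (c * 0) *: y + (c * 0) *: z = c *: x,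
      (c * (0 - 0)) *: x + (c * (1 - 0)) *: y + (c * (0 - 0)) *: z = c *: y
    & (c * 0) *: x + (c * 0) *: y + (c * 1) *: z = c *: z].
Proof. by split; rewrite !(subr0, mulr0, mulr1, scale0r, add0r, addr0). Qed.

Lemma loopZ (c : K) g p : loop (c *: sl2_mx K g) p = c *: mode K g p.
Proof.
have [hx hy hz] := scale_unit_basis c (mode K Xneg p) (mode K Hcar p) (mode K Xpos p).
rewrite /loop !mxE; case: g; rewrite /= !mxE /=;
  [exact: hx|exact: hy|exact: hz].
Qed.

Lemma sl2_loop e f p :
  loop (sl2_mx K e *m sl2_mx K f - sl2_mx K f *m sl2_mx K e) p =
  (br e f)%:~R *: mode K (tg e f) p.
Proof.
rewrite -loopZ; congr (loop _ p); apply/matrixP => i j.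
rewrite ![(_ - _ : 'M[K]_2) _ _]mxE ![(- _ : 'M[K]_2) _ _]mxE !sl2_mulmx.
by rewrite sl2_commutator [RHS]mxE.
Qed.

Lemma sl2_trace e f : \tr (sl2_mx K e *m sl2_mx K f) = (kf e f)%:~R.
Proof.
rewrite /mxtrace !big_ord_recl big_ord0 !sl2_mulmx.
by case: e; case: f; rewrite /= !mxE /=
  ?(mulr0, mul0r, mulr1, mul1r, addr0, add0r, subr0, sub0r, oppr0, mulrNN).
Qed.

Lemma bracketU (b c : option (sl2_basis * int)) :
  bracket (<< b >> : affine_sl2 K) << c >> = bracket_basis K b c.
Proof.
rewrite /bracket !msuppU oner_eq0 !big_seq_fset1 !mcoeffU !eqxx mulr1.
exact: scale1r.
Qed.

End BasisBrackets.

Section StandardModule.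
Variables (K : numFieldType) (k i : nat) (V : lmodType K).
Variables (rho : affine_sl2 K -> V -> V) (v : V).
Hypothesis std : is_standard_module rho k i v.

Let rho_mod : is_affine_module rho. Proof. by case: std. Qed.

Definition rho_op (x : affine_sl2 K) (w : V) : V := rho x w.

Lemma rho_op_linear x : linear (rho_op x).
Proof. by case: rho_mod => + _ _; apply. Qed.

HB.instance Definition _ x :=
  GRing.isLinear.Build K V V *:%R (rho_op x) (rho_op_linear x).

Lemma rho_opDl x y w : rho_op (x + y) w = rho_op x w + rho_op y w.
Proof.
case: rho_mod => _ /(_ w 1 x y) + _.
by rewrite -/(rho_op _ _) !scale1r.
Qed.

Lemma rho_op0 w : rho_op 0 w = 0.
Proof.
have := rho_opDl 0 0 w; rewrite addr0 => e.
by apply: (addrI (rho_op 0 w)); rewrite addr0 -e.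
Qed.

Lemma rho_opZl a x w : rho_op (a *: x) w = a *: rho_op x w.
Proof.
case: rho_mod => _ /(_ w a x 0) + _; rewrite -!/(rho_op _ _).
by rewrite rho_op0 !addr0.
Qed.

Lemma rho_opC x y w :
  rho_op x (rho_op y w) = rho_op y (rho_op x w) + rho_op (bracket x y) w.
Proof. by rewrite /rho_op; case: rho_mod => _ _ ->; rewrite [RHS]addrC subrK. Qed.

Lemma bracket_central (x : affine_sl2 K) : bracket (central K) x = 0.
Proof.
rewrite /bracket /central msuppU oner_eq0 big_seq_fset1.
apply: big1 => c _; exact: scaler0.
Qed.

(** The vectors on which the central element acts as on v form a submodule. *)
Lemma central_act w : rho_op (central K) w = k%:R *: w.
Proof.
case: (std) => _ [_ irr] _ [v0 _ _ _ vk].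
pose S : set V := fun w => rho_op (central K) w = k%:R *: w.
have [|S0|S1] := irr S; last exact: S1.
  split=> [|a u u' Su Su'|x u Su]; rewrite /S.
  - by rewrite linear0 scaler0.
  - rewrite linearP /= (_ : rho_op (central K) u = k%:R *: u) //.
    rewrite (_ : rho_op (central K) u' = k%:R *: u') //.
    by rewrite scalerDr !scalerA [a * _]mulrC.
  - have := rho_opC (central K) x u.
    rewrite bracket_central rho_op0 addr0.
    by rewrite (_ : rho_op (central K) u = k%:R *: u) // linearZ.
by case/eqP: v0; apply: S0.
Qed.

Lemma rho_currents e f m n w : rho_op (mode K e m) (rho_op (mode K f n) w) =
  rho_op (mode K f n) (rho_op (mode K e m) w)
  + (br e f)%:~R *: rho_op (mode K (tg e f) (m + n)) w
  + ((m * kf e f)%:~R * (m + n == 0)%:R * k%:R) *: w.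
Proof.
apply: etrans (rho_opC _ _ _) _; apply: etrans (addrA _ _ _); congr (_ + _).
have -> : bracket (mode K e m) (mode K f n) =
    (br e f)%:~R *: mode K (tg e f) (m + n)
    + (m%:~R * (kf e f)%:~R * (m + n == 0)%:R) *: central K.
  apply: (etrans (bracketU K (Some (e, m)) (Some (f, n)))).
  by rewrite /bracket_basis sl2_loop sl2_trace.
rewrite rho_opDl !rho_opZl; congr (_ + _).
by rewrite central_act scalerA intrM.
Qed.

Definition std_currents : currents k V := Currents rho_currents.

Lemma std_hw_vector : hw_vector std_currents i v.
Proof. by case: (std) => _ _ _ []. Qed.

(** The two simple lowering operators are locally nilpotent. *)
Lemma std_dominant : dominant std_currents.
Proof.
by case: (std) => _ _ [_ nY _ nX] _;
  exact: (@nilpotent_dominant _ _ _ std_currents nY nX).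
Qed.

Lemma std_Unbar_act a w : Unbar_act rho a w = uact (cop std_currents Xpos) a w.
Proof. exact: erefl. Qed.

End StandardModule.

(** * The presentations *)

Lemma fset_argmin (T : choiceType) (s : {fset T}) (f : T -> int) u : u \in s ->
  exists2 u0, u0 \in s & forall u, u \in s -> f u0 <= f u.
Proof.
move=> us; pose x0 : s := [` us]%fset.
have [z _ zmin] :=
  @Order.TotalTheory.arg_minP _ int s x0 xpredT (fun y => f (val y)) isT.
exists (val z) => [|y ys]; first exact: valP.
exact: (zmin [` ys]%fset isT).
Qed.

Section Kernel.
Variables (K : numClosedFieldType) (k i : nat) (V : lmodType K).
Variables (C : currents k V) (v : V).
Hypotheses (ik : (i <= k)%N) (dC : dominant C) (hv : hw_vector C i v).
Local Notation J := (relideal (xa K) (@Unbar_le K (-1)) k i).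

Let L1 := @Ule1 K (-1).
Let LD := @UleD K (-1).
Let LZ := @UleZ K (-1).

Lemma msupp_sub_proj d (a : Unbar K) u : u \in msupp a -> deg xwt u = d ->
  (#|` msupp (a - proj xwt d a)| < #|` msupp a|)%N.
Proof.
move=> ua du; apply: fproper_ltn_card; rewrite fproperEneq.
have nu : u \notin msupp (a - proj xwt d a).
  by rewrite -mcoeff_eq0 mcoeffB mcoeff_proj du eqxx subrr.
apply/andP; split; first by apply/eqP => e; rewrite e ua in nu.
apply/fsubsetP => w; rewrite -!mcoeff_neq0 mcoeffB mcoeff_proj.
by case: (_ == d); rewrite ?subrr ?eqxx // subr0.
Qed.

(** Induction on the number of monomials: the component of lowest principal degree
    is in the ideal, by the comparison with the Fock space, and can be removed since
    the ideal is contained in the kernel. *)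
Lemma ker_relideal (a : Unbar K) :
  Unbar_le (-1) a -> uact (cop C Xpos) a v = 0 -> J a.
Proof.
have [F [CF [U [vF [T [hF TX Tv]]]]]] := fock_model K k.
move: {2}(#|` msupp a|).+1 (ltnSn #|` msupp a|) => N.
elim: N a => // N IH a aN ha av.
have [->|a0] := eqVneq a 0; first exact: (relideal0 _ L1 LZ).
have /fset0Pn[u ua] : msupp a != fset0 by rewrite msupp_eq0.
have [u0 u0a u0min] := fset_argmin (fun u => pdeg (deg xwt u)) ua.
set d := deg xwt u0 in u0min.
have pF : uact (cop CF Xpos) (proj xwt d a) (vF i) = 0.
  exact: (unitary_kernel hv (hF i ik) U u0min av).
have hp : Unbar_le (-1) (proj xwt d a) by apply: Ule_proj.
have pJ : J (proj xwt d a).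
  by apply: (fock_kernel U hF TX Tv ik hp _ pF); apply: proj_homog.
rewrite -[a](subrK (proj xwt d a)); apply: (relidealD L1 LD LZ); last exact: pJ.
apply: IH.
- by apply: leq_trans (msupp_sub_proj u0a (erefl d)) _; rewrite -ltnS.
- exact: UleB.
by rewrite uactBl av (relideal_ker ik dC hv pJ) subrr.
Qed.

End Kernel.

Section Presentations.
Variable K : numClosedFieldType.
Implicit Types (k i t : nat) (a : Unbar K).
Local Notation J := (relideal (xa K) (@Unbar_le K (-1))).

Let L1 := @Ule1 K (-1).
Let LD := @UleD K (-1).
Let LM := @UleM K (-1).
Let LZ := @UleZ K (-1).

Let M1 := @Ule1 K (-2).
Let MD := @UleD K (-2).
Let MM := @UleM K (-2).
Let MZ := @UleZ K (-2).

Lemma Rel_rel d k t : Rel K d k t = rel (xa K) d k.+1 t.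
Proof. exact: esym (Rel_prod_poly _ _ _ _). Qed.

Lemma eq_relspan L m (r r' : nat -> Unbar K) a :
  r =1 r' -> relspan L m r a -> relspan L m r' a.
Proof.
move=> rr [N [g [hg ->]]]; exists N, g; split; first exact: hg.
by apply: eq_bigr => t _; congr (_ * _); exact: rr.
Qed.

Lemma I_LambdaE k i a : I_Lambda k i a <-> J k i a.
Proof.
split=> [[N [g [b [hg hb ->]]]]|[s [b [hs hb ->]]]].
  exists (\sum_(k.+1 <= t < N) g t * R0 K k t), b; split; [|exact: hb|exact: erefl].
  apply: (eq_relspan (Rel_rel 1 k)); by exists N, g.
have [N [g [hg ->]]] := eq_relspan (fun t => esym (Rel_rel 1 k t)) hs.
by exists N, g, b.
Qed.

Lemma I'_LambdaE k a :
  I'_Lambda k a <-> relspan (@Unbar_le K (-2)) (2 * k.+1) (rel (xa K) 2 k.+1) a.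
Proof.
split=> [[N [g [hg ->]]]|hs].
  apply: (eq_relspan (Rel_rel 2 k)); by exists N, g.
by have [N [g [hg ->]]] := eq_relspan (fun t => esym (Rel_rel 2 k t)) hs; exists N, g.
Qed.

Lemma drop1_cur p : subst (drop1 K) (cur (xa K) 1 p) = cur (xa K) 2 p.
Proof.
rewrite /cur; case: p => [|[|p]] /=; try exact: rmorph0.
  by rewrite subst_xa /drop1 eqxx.
by rewrite subst_xa /drop1.
Qed.

(** Setting x(-1) to zero turns the first family of relations into the second
    one, and it kills the power of x(-1). *)
Lemma drop1_relideal k i a : J k i a ->
  relspan (@Unbar_le K (-2)) (2 * k.+1) (rel (xa K) 2 k.+1) (subst (drop1 K) a).
Proof.
case=> s [b [[N [g [hg ->]]] _ ->]].
set s' := \sum_(_ <= _ < _) _.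
have -> : subst (drop1 K) (s' + b * xa K (-1) ^+ (k - i + 1)) = subst (drop1 K) s'.
  apply: etrans (rmorphD _ _ _) _; rewrite [X in _ + X]rmorphM rmorphXn /=.
  have -> : subst (drop1 K) (xa K (-1)) = 0 by rewrite subst_xa /drop1 eqxx.
  by rewrite addn1 expr0n mulr0 addr0.
rewrite /s' rmorph_sum; apply: (relspan_sum M1 MD MZ) => t _; rewrite rmorphM /=.
apply: (relspanM MM); first by apply: Ule_drop1.
rewrite (rmorph_rel (y := xa K) (e := 2)) => [|p]; last exact: drop1_cur.
by apply: (relspan_gen M1 MZ) => ? ?; apply: rel_low.
Qed.

Lemma I_Lambda_Ule k i a : I_Lambda k i a -> Unbar_le (-1) a.
Proof.
case=> N [g [b [hg hb ->]]]; apply: UleD; last first.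
  by apply: UleM; [exact: hb|apply/UleX/Ule_xa].
apply: Ule_sum => t _; apply: UleM; first exact: hg.
rewrite /R0 Rel_rel; apply: (L_rel L1 LD LM LZ) => p p1; apply: Ule_xa; lia.
Qed.

Lemma I'_Lambda_Ule k a : I'_Lambda k a -> Unbar_le (-2) a.
Proof.
case=> N [g [hg ->]]; apply: Ule_sum => t _; apply: UleM; first exact: hg.
rewrite /R1 Rel_rel.
apply: (L_rel M1 MD MM MZ).
by move=> p p2; apply: Ule_xa; lia.
Qed.

Lemma I'_Lambda_sub k a : I'_Lambda k a -> I_Lambda k k a.
Proof.
case=> N [g [hg ->]]; apply/I_LambdaE; apply: (relideal_sum L1 LD LZ) => t _.
rewrite /R1 Rel_rel; apply: (relidealM LM); first exact: Ule_sub (hg t).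
have := relideal_rel2 L1 LD LM LZ k k (@Uneg_xneg K) t.
by rewrite subnn expr0 mul1r.
Qed.

End Presentations.

Section Standard.
Variables (K : numClosedFieldType) (k i : nat) (V : lmodType K).
Variables (rho : affine_sl2 K -> V -> V) (v : V).
Hypotheses (ik : (i <= k)%N) (std : is_standard_module rho k i v).

Lemma Unbar_act_ker (a : Unbar K) : Unbar_le (-1) a ->
  Unbar_act rho a v = 0 <-> I_Lambda k i a.
Proof.
move=> ha; rewrite I_LambdaE.
have e := std_Unbar_act std a v.
split=> [av|hJ].
  apply: (ker_relideal ik (std_dominant std) (std_hw_vector std) ha).
  exact: etrans (esym e) av.
exact: etrans e (relideal_ker ik (std_dominant std) (std_hw_vector std) hJ).
Qed.

End Standard.

Theorem theorem3p1 (R : realType) (k : nat) (hk : (1 <= k)%N) :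
  (forall i : nat, (i <= k)%N ->
     forall (V : lmodType R[i]) (rho : affine_sl2 R[i] -> V -> V) (v : V),
       is_standard_module rho k i v ->
       Ker_f rho (-1) v = I_Lambda k i) /\
  (forall (V : lmodType R[i]) (rho : affine_sl2 R[i] -> V -> V) (v : V),
     is_standard_module rho k k v ->
     Ker_f rho (-2) v = I'_Lambda k).
Proof.
split=> [i ik V rho v std|V rho v std]; apply/seteqP; split=> a.
- by case=> ha av; apply/(Unbar_act_ker ik std ha).
- move=> Ia; have ha := I_Lambda_Ule Ia.
  by split=> //; apply/(Unbar_act_ker ik std ha).
- case=> ha av; apply/I'_LambdaE; rewrite -(drop1_id ha).
  apply: (@drop1_relideal _ k k); apply/I_LambdaE.
  by apply/(Unbar_act_ker (leqnn k) std) => //; apply: Ule_sub ha.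
move=> Ia; have ha := I'_Lambda_Ule Ia.
split=> //; apply/(Unbar_act_ker (leqnn k) std); first exact: Ule_sub ha.
exact: I'_Lambda_sub.
Qed.
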